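(* Let $d=d(n)$ and $n$ be positive integers with $d=\omega(1)$, and suppose there is a constant $a>0$ such that $d\le n^{1-a}$. Let $\epsilon>0$ be a sufficiently small constant and let $k\in\mathbb{N}$ be a constant. Then for every constant $c>0$ there exists a sufficiently large constant $C=C(c,k)>0$ such that the following holds. Let $G=(V,E)$ be a $d$-regular graph on $n$ vertices satisfying: (P1) for every $U\subseteq V$ with $|U|\le n/2$, $e(U,U^C)\ge c|U|$; and (P2) for every $U\subseteq V$ with $|U|\le Cd\log n$, $e(U,U^C)\ge (1-\epsilon)d|U|$. Consider the random graph process on $G$, let $\tau_k$ be the hitting time of having minimum degree at least $k$, and let $\tau_{kc}$ be the hitting time of being $k$-connected. Then, with high probability, $\tau_k=\tau_{kc}$.
   Context: All asymptotics are as $n\to\infty$; a statement holds ''with high probability'' (whp) if its probability tends to $1$ as $n\to\infty$. Statements about ''a $d$-regular $n$-vertex graph'' are to be understood for sequences $(d_k,n_k)$ and corresponding sequences of graphs. For $U\subseteq V$, $U^C=V\setminus U$ and $e(U,U^C)$ is the number of edges of $G$ with exactly one endpoint in $U$. Logarithms are natural. The random graph process on $G=(V,E)$: $G(0)$ is the empty graph on $V$, and for $1\le i\le |E|$, $G(i)$ is obtained from $G(i-1)$ by adding an edge chosen uniformly at random from $E\setminus E(G(i-1))$. The hitting time of a monotone increasing graph property $\mathcal{P}$ is the minimum index $\tau$ with $G(\tau)\in\mathcal{P}$. *)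

(* Defs.v *)
From mathcomp Require Import all_boot all_order all_algebra.

Set Implicit Arguments.
Unset Strict Implicit.
Unset Printing Implicit Defensive.

Import GRing.Theory.

Section Graphs.
Variable T : finType.

(* A graph on the vertex set T is given by its edge set; an edge is the
   two-element set of its endpoints. *)
Definition simple_graph (E : {set {set T}}) : Prop :=
  forall e, e \in E -> #|e| = 2.

Definition degree (E : {set {set T}}) (v : T) : nat :=
  #|[set e in E | v \in e]|.

Definition regular (d : nat) (E : {set {set T}}) : Prop :=
  forall v, degree E v = d.

(* e(U, U^C) *)
Definition edge_boundary (E : {set {set T}}) (U : {set T}) : nat :=
  #|[set e in E | #|e :&: U| == 1]|.

Definition min_degree_ge (k : nat) (E : {set {set T}}) : bool :=
  [forall v, k <= degree E v].

Definition adj_avoiding (E : {set {set T}}) (S : {set T}) : rel T :=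
  [rel x y | [&& x \notin S, y \notin S & [set x; y] \in E]].

(* More than k vertices, and G - S is connected whenever |S| < k. *)
Definition k_connected (k : nat) (E : {set {set T}}) : bool :=
  (k < #|T|) &&
  [forall S : {set T}, (#|S| < k) ==>
     [forall x in ~: S, forall y in ~: S, connect (adj_avoiding E S) x y]].

(* A trajectory of the random graph process on E is recorded by the tuple of
   the successively added edges; [graph_at s i] is G(i). *)
Definition graph_at (s : seq {set T}) (i : nat) : {set {set T}} :=
  [set:: take i s].

(* The conditional probability that the next edge is e when the current graph
   is H. *)
Definition step_prob (R : realFieldType) (E H : {set {set T}}) (e : {set T})
    : R :=
  if e \in E :\: H then (#|E :\: H|%:R)^-1%R else 0%R.

Definition trajectory_prob (R : realFieldType) (E : {set {set T}})
    (s : #|E|.-tuple {set T}) : R :=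
  (\prod_(i < #|E|) step_prob R E (graph_at s i) (tnth s i))%R.

Definition process_prob (R : realFieldType) (E : {set {set T}})
    (A : pred (#|E|.-tuple {set T})) : R :=
  (\sum_(s | A s) trajectory_prob R s)%R.

(* The least i <= |E| with P (G(i)), and |E| + 1 if there is none. *)
Definition hitting_time (E : {set {set T}}) (P : pred {set {set T}})
    (s : #|E|.-tuple {set T}) : nat :=
  find (fun i => P (graph_at s i)) (iota 0 #|E|.+1).

End Graphs.

(* Main.v *)
Require Import Defs.
From mathcomp Require Import all_classical all_reals all_analysis.
From mathcomp Require Import all_boot all_order all_algebra.
From mathcomp Require Import ring lra zify.

(** A Bernoulli subset of E conditioned on its size m is distributed as G(m),
    so it suffices to show that a random G = H0 u H1 u H2, the union of three
    independent Bernoulli subsets of E, has with high probability an isolated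
    vertex, so that neither hitting time has been reached, while every
    G <= K <= E of minimum degree at least k is k-connected. Here an edge is
    missing from H0 with probability n^(-(1-b/4)/d), where b = min(a, 1/2), and
    from H1 and H2 with probability e^(-4/d) and e^(-1/d). The second moment
    method gives the isolated vertex.

    With high probability every connected W in H0 with 2 <= |W| <= C d log n
    has more than k|W| boundary edges in H0 (first moment over breadth-first
    search codes, using P2), and no two vertices of H0-degree below k are
    adjacent in E. Hence for |S| < k the components of H0 - S are either larger
    than C d log n or single vertices, and the latter form an independent set J
    of E. A disconnection of K - S thus separates the large components into two
    nonempty classes X and Y. Attaching each vertex of J to the class in which
    it has more neighbours, P1 yields at least c|X| - kd edges that either join
    X to Y or join a vertex of J to its minority class. If H1 links a vertex of
    J to its majority class and H2 uses one of its minority edges, then X and Y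
    are connected; so the probability that H1 and H2 link X and Y nowhere is at
    most n^(-(k+2)) to the number of components in X, which beats the union
    bound over S and X. *)

Set Implicit Arguments.
Unset Strict Implicit.
Unset Printing Implicit Defensive.

Import Order.TTheory GRing.Theory Num.Theory.
Import numFieldNormedType.Exports.
Local Open Scope ring_scope.

(** * Bernoulli subsets *)

Lemma prod_if_subset (R : comPzSemiRingType) (F : finType) (A B : {set F}) (a : F -> R) :
  B \subset A -> \prod_(e in A) (if e \in B then a e else 1) = \prod_(e in B) a e.
Proof.
move=> BA; rewrite -big_mkcondr; apply: eq_bigl => e.
by rewrite andbC; case: (boolP (e \in B)) => //= /(subsetP BA).
Qed.

Lemma sum_powerset_prod (R : comPzSemiRingType) (F : finType) (A : {set F})
    (a b : F -> R) :
  \sum_(H in powerset A) \prod_(e in A) (if e \in H then a e else b e)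
  = \prod_(e in A) (a e + b e).
Proof.
pose a' e := if e \in A then a e else 0; pose b' e := if e \in A then b e else 1.
have -> : \prod_(e in A) (a e + b e) = \prod_e (a' e + b' e).
  rewrite big_mkcond; apply: eq_bigr => e _.
  by rewrite /a' /b'; case: ifP => // _; rewrite add0r.
rewrite bigA_distr [RHS](bigID (mem (powerset A))) /= [X in _ + X]big1 ?addr0.
  apply: eq_bigr => H; rewrite powersetE => HA.
  rewrite big_mkcond; apply: eq_bigr => e _; rewrite /a' /b'.
  by case: ifP => // eA; case: ifP => // /(subsetP HA); rewrite eA.
move=> H; rewrite powersetE => /subsetPn[e eH eA].
by rewrite (bigD1 e) //= eH /a' (negbTE eA) mul0r.
Qed.

Lemma sum_expr_card (R : comPzSemiRingType) (F : finType) (x : R) :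
  \sum_(A : {set F}) x ^+ #|A| = (1 + x) ^+ #|F|.
Proof.
rewrite addrC -cardsT -prodr_const -sum_powerset_prod.
rewrite [RHS](eq_bigl xpredT) => [|A]; last by rewrite powersetE subsetT.
by apply: eq_bigr => A _; rewrite prod_if_subset ?subsetT // prodr_const.
Qed.

Lemma natr_eq_set (R : comPzSemiRingType) (F : finType) (E H K : {set F}) :
  H \subset E -> K \subset E ->
  (H == K)%:R = \prod_(e in E) (if e \in H then (e \in K)%:R else (e \notin K)%:R) :> R.
Proof.
move=> HE KE; case: eqVneq => [->|HK].
  by rewrite big1 // => e _; case: (e \in K).
have /existsP[e eHK] : [exists e, (e \in H) != (e \in K)].
  apply: contraNT HK; rewrite negb_exists => /forallP HK.
  by apply/eqP/setP => e; apply/eqP; rewrite -[_ == _]negbK.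
have eE : e \in E.
  apply: contraR eHK => eE.
  by rewrite (contraNF (subsetP HE e) eE) (contraNF (subsetP KE e) eE).
by rewrite (bigD1 e) //=; case: (e \in H) (e \in K) eHK => [] [] //= _; rewrite mul0r.
Qed.

Lemma natr_exists_le_sum (R : numDomainType) (I : finType) (D A : pred I) :
  [exists (i | D i), A i]%:R <= \sum_(i | D i) (A i)%:R :> R.
Proof.
case: existsP => [[i /andP[Di Ai]]|_]; last by rewrite sumr_ge0.
by rewrite (bigD1 i) //= Ai lerDl sumr_ge0.
Qed.

Section Bernoulli.
Variables (R : realFieldType) (F : finType) (E : {set F}).
Implicit Types (q x : R) (A B H K : {set F}) (f g : {set F} -> R) (P Q : pred {set F}).

(* Here q is the probability that an element of E is left out. *)
Definition bweight q H : R := \prod_(e in E) (if e \in H then 1 - q else q).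

Definition bexp q f : R := \sum_(H in powerset E) bweight q H * f H.

Definition bpr q P : R := bexp q (fun H => (P H)%:R).

Lemma bexp_prod q (a b : F -> R) :
  bexp q (fun H => \prod_(e in E) (if e \in H then a e else b e))
  = \prod_(e in E) ((1 - q) * a e + q * b e).
Proof.
rewrite -sum_powerset_prod; apply: eq_bigr => H _.
by rewrite -big_split; apply: eq_bigr => e _ /=; case: ifP.
Qed.

Lemma eq_bexp q f g : (forall H, H \subset E -> f H = g H) -> bexp q f = bexp q g.
Proof. by move=> fg; apply: eq_bigr => H; rewrite powersetE => /fg->. Qed.

Lemma eq_bpr q P Q : (forall H, H \subset E -> P H = Q H) -> bpr q P = bpr q Q.
Proof. by move=> PQ; apply: eq_bexp => H /PQ->. Qed.

Lemma bexp_cst q x : bexp q (fun=> x) = x.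
Proof.
rewrite /bexp -big_distrl /= sum_powerset_prod big1 ?mul1r // => e _.
by rewrite subrK.
Qed.

Lemma bexpZ q x f : bexp q (fun H => x * f H) = x * bexp q f.
Proof. by rewrite /bexp big_distrr; apply: eq_bigr => H _; rewrite mulrCA. Qed.

Lemma bexpD q f g : bexp q (fun H => f H + g H) = bexp q f + bexp q g.
Proof. by rewrite /bexp -big_split; apply: eq_bigr => H _; rewrite mulrDr. Qed.

Lemma bexp_sum q (I : Type) (r : seq I) (D : pred I) (f : I -> {set F} -> R) :
  bexp q (fun H => \sum_(i <- r | D i) f i H) = \sum_(i <- r | D i) bexp q (f i).
Proof.
by rewrite /bexp exchange_big; apply: eq_bigr => H _; rewrite big_distrr.
Qed.

Section Monotone.
Variable q : R.
Hypothesis q_prob : 0 <= q <= 1.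

Lemma bweight_ge0 H : 0 <= bweight q H.
Proof.
case/andP: q_prob => q_ge0 q_le1.
by apply: prodr_ge0 => e _; case: ifP; rewrite ?subr_ge0.
Qed.

Lemma ler_bexp f g : (forall H, H \subset E -> f H <= g H) -> bexp q f <= bexp q g.
Proof.
move=> fg; apply: ler_sum => H; rewrite powersetE => HE.
by rewrite ler_wpM2l ?bweight_ge0 ?fg.
Qed.

Lemma ler_bpr P Q : (forall H, H \subset E -> P H -> Q H) -> bpr q P <= bpr q Q.
Proof.
move=> PQ; apply: ler_bexp => H HE; rewrite ler_nat.
by case: (P H) (PQ H HE) => // ->.
Qed.

Lemma bpr_exists (I : finType) (D : pred I) (A : I -> pred {set F}) :
  bpr q (fun H => [exists (i | D i), A i H]) <= \sum_(i | D i) bpr q (A i).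
Proof. by rewrite -bexp_sum; apply: ler_bexp => H _; apply: natr_exists_le_sum. Qed.

End Monotone.

Lemma bexp_bpr_exists q q' (I : finType) (D : pred I) (A : I -> {set F} -> pred {set F}) :
  0 <= q <= 1 -> 0 <= q' <= 1 ->
  bexp q (fun H => bpr q' (fun H' => [exists (i | D i), A i H H']))
  <= \sum_(i | D i) bexp q (fun H => bpr q' (A i H)).
Proof.
move=> q_prob q'_prob; rewrite -bexp_sum.
by apply: ler_bexp => // H _; apply: bpr_exists.
Qed.

Lemma bexp_superset_expr_setI q x A B : A \subset E -> B \subset E -> [disjoint A & B] ->
  bexp q (fun H => (A \subset H)%:R * x ^+ #|B :&: H|)
  = (1 - q) ^+ #|A| * (q + (1 - q) * x) ^+ #|B|.
Proof.
move=> AE BE disAB.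
pose present e : R := if e \in B then x else 1.
pose absent e : R := if e \in A then 0 else 1.
transitivity (bexp q (fun H => \prod_(e in E) (if e \in H then present e else absent e))).
  apply: eq_bexp => H HE; case: (boolP (A \subset H)) => [AH|]; last first.
    case/subsetPn=> e eA eH; rewrite mul0r (bigD1 e) ?(subsetP AE) //=.
    by rewrite (negbTE eH) /absent eA mul0r.
  have BHE : B :&: H \subset E := subset_trans (subsetIl _ _) BE.
  rewrite mul1r -prodr_const -(prod_if_subset _ BHE).
  apply: eq_bigr => e _; rewrite inE /present /absent.
  case: (boolP (e \in H)) => eH; rewrite ?andbT ?andbF //.
  by case: ifP => // /(subsetP AH); rewrite (negbTE eH).
rewrite bexp_prod -!prodr_const -(prod_if_subset _ AE) -(prod_if_subset _ BE) -big_split.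
apply: eq_bigr => e _; rewrite /present /absent /=.
case: (boolP (e \in A)) => [/(disjointFr disAB)->|_]; first by ring.
by case: ifP => _; ring.
Qed.

Lemma bpr_absent q B : B \subset E -> bpr q (fun H => [disjoint B & H]) = q ^+ #|B|.
Proof.
move=> BE; have := bexp_superset_expr_setI q 0 (sub0set E) BE.
rewrite cards0 mulr0 addr0 expr0 mul1r => <-; last by rewrite -setI_eq0 set0I.
by apply: eq_bexp => H _; rewrite sub0set mul1r expr0n cards_eq0 setI_eq0.
Qed.

Lemma bexp_setU q q' f :
  bexp q (fun H => bexp q' (fun H' => f (H :|: H'))) = bexp (q * q') f.
Proof.
have expand H H' : H \subset E -> H' \subset E ->
    f (H :|: H') = \sum_(K in powerset E) f K * (H :|: H' == K)%:R.
  move=> HE H'E; rewrite (bigD1 (H :|: H')) ?powersetE ?subUset ?HE //= eqxx mulr1.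
  by rewrite big1 ?addr0 // => K /andP[_ /negbTE KH]; rewrite eq_sym KH mulr0.
under eq_bexp => H HE.
  under eq_bexp => H' H'E do rewrite (expand _ _ HE H'E).
  by rewrite bexp_sum; under eq_bigr do rewrite bexpZ; over.
rewrite bexp_sum; apply: eq_bigr => K; rewrite powersetE => KE.
rewrite bexpZ mulrC; congr (_ * _).
transitivity (bexp q (fun H => \prod_(e in E)
    if e \in H then (e \in K)%:R else (1 - q') * (e \in K)%:R + q' * (e \notin K)%:R)).
  apply: eq_bexp => H HE; transitivity (bexp q' (fun H' => \prod_(e in E)
      if e \in H' then (e \in K)%:R else
      if e \in H then (e \in K)%:R else (e \notin K)%:R)).
    apply: eq_bexp => H' H'E; rewrite (@natr_eq_set _ _ E) ?subUset ?HE //.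
    by apply: eq_bigr => e _; rewrite inE; case: (e \in H); rewrite //= if_same.
  by rewrite bexp_prod; apply: eq_bigr => e _; case: ifP => _; ring.
by rewrite bexp_prod; apply: eq_bigr => e _; case: (e \in K) => /=; ring.
Qed.

Lemma bweightE q K : K \subset E -> bweight q K = (1 - q) ^+ #|K| * q ^+ (#|E| - #|K|).
Proof.
move=> KE; have -> : (#|E| - #|K|)%N = #|E :\: K| by rewrite cardsD (setIidPr KE).
rewrite -!prodr_const -(prod_if_subset _ KE) -(prod_if_subset _ (subsetDl E K)).
rewrite -big_split; apply: eq_bigr => e eE /=.
by rewrite inE eE andbT; case: (e \in K); rewrite ?mulr1 ?mul1r.
Qed.

End Bernoulli.

(** * The random graph process *)

Lemma nth_notin_take_uniq (U : eqType) (x0 : U) (s : seq U) :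
  (forall i, (i < size s)%N -> nth x0 s i \notin take i s) -> uniq s.
Proof.
elim/last_ind: s => // s x IHs fresh; rewrite rcons_uniq; apply/andP; split.
  have := fresh (size s); rewrite size_rcons => /(_ (leqnn _)).
  by rewrite nth_rcons ltnn eqxx -cats1 take_size_cat.
apply: IHs => i i_lt; have := fresh i; rewrite size_rcons => /(_ (leqW i_lt)).
by rewrite nth_rcons i_lt -cats1 take_cat i_lt.
Qed.

Lemma graph_atS (T : finType) (s : seq {set T}) i j :
  (i <= j)%N -> graph_at s i \subset graph_at s j.
Proof.
move=> ij; apply/subsetP => e; rewrite !inE => es.
by move: es; rewrite -(take_takel s ij); apply: mem_take.
Qed.

Section Process.
Variables (R : realFieldType) (T : finType) (E : {set {set T}}).
Implicit Types (s : #|E|.-tuple {set T}) (K : {set {set T}}).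
Implicit Types (A : pred (#|E|.-tuple {set T})) (good : pred {set {set T}}).

Definition ordering s : bool := uniq s && all (mem E) s.

Lemma graph_at_sub s m : ordering s -> graph_at s m \subset E.
Proof.
case/andP=> _ /allP sE; apply/subsetP => e; rewrite inE => /mem_take; exact: sE.
Qed.

Lemma card_graph_at s m : ordering s -> (m <= #|E|)%N -> #|graph_at s m| = m.
Proof.
case/andP=> us _ mE; rewrite cardsE; move/card_uniqP: (take_uniq m us) => ->.
by rewrite size_takel // size_tuple.
Qed.

Lemma trajectory_probE s :
  trajectory_prob R s = if ordering s then (#|E| `!)%:R^-1 else 0.
Proof.
rewrite /trajectory_prob; case: ifP => os.
  transitivity (\prod_(i < #|E|) ((#|E| - i)%:R^-1 : R)).
    apply: eq_bigr => i _; rewrite /step_prob.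
    have [us /allP sE] := andP os.
    have -> : tnth s i \in E :\: graph_at s i.
      have eE : tnth s i \in E by exact: sE _ (mem_tnth i s).
      rewrite in_setD eE andbT inE.
      rewrite (tnth_nth (tnth s i)) in_take_leq ?size_tuple ?(ltnW (ltn_ord i)) //.
      by rewrite index_uniq ?size_tuple // ltnn.
    rewrite cardsD (setIidPr (graph_at_sub _ os)) card_graph_at //.
    exact: ltnW (ltn_ord i).
  by rewrite prodfV -natr_prod -ffact_prod ffactnn.
apply/eqP; rewrite prodf_seq_eq0; apply: contraFT os => /hasPn steps.
have {}steps (i : 'I_#|E|) : tnth s i \in E :\: graph_at s i.
  have := steps i (mem_index_enum _); rewrite /step_prob /=.
  by case: ifP => //; rewrite eqxx.
apply/andP; split.
  apply: (nth_notin_take_uniq (x0 := set0)) => i; rewrite size_tuple => i_lt.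
  by have := steps (Ordinal i_lt); rewrite !inE (tnth_nth set0) => /andP[].
by apply/allP => e /tnthP[i ->]; have := steps i; rewrite in_setD => /andP[].
Qed.

Lemma trajectory_prob_ge0 s : 0 <= trajectory_prob R s.
Proof. by rewrite trajectory_probE; case: ifP => // _; rewrite invr_ge0. Qed.

Lemma process_probE A :
  process_prob R A =
  #|[set s : #|E|.-tuple {set T} | A s && ordering s]|%:R / (#|E| `!)%:R.
Proof.
rewrite /process_prob; under eq_bigr do rewrite trajectory_probE.
by rewrite -big_mkcondr sumr_const /= mulr_natl cardsE.
Qed.

Lemma process_probT : process_prob R (xpredT : pred (#|E|.-tuple {set T})) = 1.
Proof.
rewrite process_probE.
have -> : #|[set s : #|E|.-tuple {set T} | ordering s]| = #|E| `!.
  rewrite -ffactnn -(@card_uniq_tuples _ #|E| (mem E)); congr #|pred_of_set _|.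
  by apply/setP => s; rewrite !inE andbC.
by rewrite divff // pnatr_eq0 -lt0n fact_gt0.
Qed.

Lemma process_probC A : process_prob R (predC A) = 1 - process_prob R A.
Proof.
by rewrite -process_probT /process_prob [in RHS](bigID A) /= addrAC subrr add0r.
Qed.

Lemma process_prob_le1 A : process_prob R A <= 1.
Proof.
rewrite -subr_ge0 -process_probC; apply: sumr_ge0 => s _.
exact: trajectory_prob_ge0.
Qed.

Lemma card_ordering_graph_at K : K \subset E ->
  #|[set s : #|E|.-tuple {set T} | (graph_at s #|K| == K) && ordering s]|
  = (#|K| `! * (#|E| - #|K|)`!)%N.
Proof.
move=> KE; set m := #|K|; have mE : (m <= #|E|)%N by exact: subset_leq_card.
have cardEK : #|E :\: K| = (#|E| - m)%N by rewrite cardsD (setIidPr KE).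
pose firsts := [set t : m.-tuple {set T} | all (mem K) t & uniq t].
pose lasts := [set t : (#|E| - m).-tuple {set T} | all (mem (E :\: K)) t & uniq t].
pose glue (t : m.-tuple {set T} * (#|E| - m).-tuple {set T}) :=
  tcast (subnKC mE) (cat_tuple t.1 t.2).
have val_glue t : tval (glue t) = t.1 ++ t.2 by rewrite val_tcast.
have take_glue t : take m (tval (glue t)) = t.1.
  by rewrite val_glue take_size_cat ?size_tuple.
have glue_inj : injective glue.
  move=> [t1 t2] [t1' t2'] /(congr1 (@tval _ _)); rewrite !val_glue => /eqP.
  by rewrite eqseq_cat ?size_tuple // => /andP[/eqP/val_inj /= -> /eqP/val_inj /= ->].
have <- : #|setX firsts lasts| = (m`! * (#|E| - m)`!)%N.
  by rewrite cardsX !card_uniq_tuples /= cardEK !ffactnn.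
rewrite -(card_imset _ glue_inj); congr #|pred_of_set _|.
apply/setP => s; rewrite inE; apply/idP/imsetP => [|[[t t'] + ->]].
  move=> /andP[/eqP sK /andP[us /allP sE]].
  have := us; rewrite -{1}(cat_take_drop m s) cat_uniq => /and3P[u1 /hasPn fresh u2].
  have size1 : size (take m s) == m by rewrite size_takel ?size_tuple.
  have size2 : size (drop m s) == (#|E| - m)%N by rewrite size_drop size_tuple.
  exists (Tuple size1, Tuple size2).
    rewrite !inE /= u1 u2 !andbT; apply/andP; split; apply/allP => e es /=.
      by rewrite -sK inE.
    have eE : e \in E by exact: sE _ (mem_drop es).
    by rewrite inE eE andbT -sK inE; apply: fresh.
  by apply/val_inj; rewrite [RHS]val_glue /= cat_take_drop.
rewrite !inE /= => /andP[/andP[/allP tK ut] /andP[/allP t'K ut']].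
rewrite /graph_at take_glue /ordering val_glue cat_uniq all_cat ut ut' /= andbT.
have sub_tK : [set:: t] \subset K by apply/subsetP => e; rewrite inE => /tK.
rewrite eqEcard sub_tK cardsE (card_uniqP ut) size_tuple leqnn /=.
apply/and3P; split.
- by apply/hasPn => e /t'K /=; rewrite inE => /andP[eK _]; apply: contra eK => /tK.
- by apply/allP => e /tK /(subsetP KE).
- by apply/allP => e /t'K /=; rewrite inE => /andP[].
Qed.

Lemma process_prob_graph_at K : K \subset E ->
  process_prob R (fun s : #|E|.-tuple {set T} => graph_at s #|K| == K)
  = ('C(#|E|, #|K|))%:R^-1.
Proof.
move=> KE; rewrite process_probE card_ordering_graph_at //.
have KEle := subset_leq_card KE.
by rewrite -(bin_fact KEle) [in X in _ / X]natrM invfM mulrCA divff ?mulr1.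
Qed.

Lemma process_prob_graph_atE good m : (m <= #|E|)%N ->
  process_prob R (fun s : #|E|.-tuple {set T} => good (graph_at s m))
  = \sum_(K in powerset E | #|K| == m) (good K)%:R / ('C(#|E|, m))%:R.
Proof.
move=> mE; transitivity (\sum_(K in powerset E | #|K| == m)
    (good K)%:R * process_prob R (fun s : #|E|.-tuple {set T} => graph_at s m == K)).
  rewrite /process_prob; under [RHS]eq_bigr do rewrite mulr_sumr big_mkcond.
  rewrite exchange_big /= big_mkcond; apply: eq_bigr => s _.
  rewrite trajectory_probE; case: (boolP (ordering s)) => os; last first.
    by rewrite if_same big1 // => K _; rewrite mulr0 if_same.
  rewrite (bigD1 (graph_at s m)) /=; last first.
    by rewrite powersetE graph_at_sub // card_graph_at //=.
  rewrite eqxx big1 ?addr0 => [|K /andP[_ /negbTE]]; last by rewrite eq_sym => ->.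
  by case: (good _); rewrite ?mul1r ?mul0r.
apply: eq_bigr => K /andP[]; rewrite powersetE => KE /eqP <-.
by rewrite process_prob_graph_at.
Qed.

Lemma bpr_process_prob (q : R) good : bpr E q good =
  \sum_(m < #|E|.+1) 'C(#|E|, m)%:R * ((1 - q) ^+ m * q ^+ (#|E| - m)) *
    process_prob R (fun s : #|E|.-tuple {set T} => good (graph_at s m)).
Proof.
rewrite /bpr /bexp (partition_big (fun K => inord #|K| : 'I_#|E|.+1) xpredT) //=.
apply: eq_bigr => m _; have mE : (m <= #|E|)%N by rewrite -ltnS.
rewrite process_prob_graph_atE // mulr_sumr.
apply: eq_big => K; first have [|] := boolP (K \in powerset E) => //=.
  by rewrite powersetE => /subset_leq_card KE; rewrite -val_eqE /= inordK.
rewrite powersetE => /andP[KE]; rewrite -val_eqE /= inordK ?ltnS ?subset_leq_card //.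
move=> /eqP Km; rewrite bweightE // Km -[in RHS]mulrA [RHS]mulrC -!mulrA.
by rewrite mulVf ?mulr1 // pnatr_eq0 -lt0n bin_gt0.
Qed.

Lemma process_probC_le_bpr (q : R) good A : 0 <= q <= 1 ->
  (forall s m, ordering s -> good (graph_at s m) -> A s) ->
  1 - process_prob R A <= bpr E q (predC good).
Proof.
move=> /andP[q_ge0 q_le1] goodA; rewrite bpr_process_prob.
have -> : 1 - process_prob R A = \sum_(m < #|E|.+1)
    'C(#|E|, m)%:R * ((1 - q) ^+ m * q ^+ (#|E| - m)) * process_prob R (predC A).
  rewrite -process_probC -mulr_suml -[LHS]mul1r; congr (_ * _).
  transitivity ((q + (1 - q)) ^+ #|E|); first by rewrite addrC subrK expr1n.
  by rewrite exprDn; apply: eq_bigr => m _; rewrite mulr_natl [_ * q ^+ _]mulrC.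
apply: ler_sum => m _; have mE : (m <= #|E|)%N by rewrite -ltnS.
rewrite ler_wpM2l ?mulr_ge0 ?exprn_ge0 ?subr_ge0 //.
rewrite !process_probE ler_wpM2r ?invr_ge0 // ler_nat subset_leq_card //.
apply/subsetP => s; rewrite !inE => /andP[nA os]; rewrite os andbT.
by apply: contra nA; apply: goodA.
Qed.

End Process.

(** * Graphs *)

Section Graphs.
Local Open Scope nat_scope.
Variable T : finType.
Implicit Types (E G H K : {set {set T}}) (S U V W : {set T}) (e : {set T}).
Implicit Types (u v w x y : T).

Definition nbrs K v : {set T} := [set w | [set v; w] \in K].

Definition star K v : {set {set T}} := [set e in K | v \in e].

Definition boundary K W : {set {set T}} := [set e in K | #|e :&: W| == 1].

Lemma star_sub K v : star K v \subset K.
Proof. by apply/subsetP => e; rewrite inE => /andP[]. Qed.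

Lemma boundary_sub K W : boundary K W \subset K.
Proof. by apply/subsetP => e; rewrite inE => /andP[]. Qed.

Lemma boundaryI E H W : H \subset E -> boundary E W :&: H = boundary H W.
Proof.
move=> HE; apply/setP => e; rewrite !inE andbAC andbC.
by case: (boolP (e \in H)) => [/(subsetP HE)->|]; rewrite ?andbT ?andbF.
Qed.

Lemma simple_graphS K E : K \subset E -> simple_graph E -> simple_graph K.
Proof. by move=> KE sE e /(subsetP KE)/sE. Qed.

Lemma simple_edge_neq K v w : simple_graph K -> [set v; w] \in K -> v != w.
Proof. by move=> sK /sK; rewrite cards2; case: eqP. Qed.

Lemma edge_other_end K e v : simple_graph K -> e \in K -> v \in e ->
  exists w, e = [set v; w].
Proof.
move=> sK /sK + ve; rewrite (cardsD1 v) ve add1n => -[] /eqP/cards1P[w ew].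
by exists w; rewrite -ew setD1K.
Qed.

Lemma boundary_ends K W e : simple_graph K -> e \in boundary K W ->
  exists u v, [/\ e = [set u; v], u \in W & v \notin W].
Proof.
move=> sK; rewrite inE => /andP[eK /cards1P[u eW]].
have [ue uW] : u \in e /\ u \in W by apply/setIP; rewrite eW set11.
have [v uv] := edge_other_end sK eK ue; exists u, v; split=> //.
have u_neq_v : u != v by apply: (simple_edge_neq sK); rewrite -uv.
apply: contra u_neq_v => vW; have : v \in e :&: W by rewrite inE uv set22.
by rewrite eW inE eq_sym.
Qed.

Lemma set2_injr v : injective (fun w => [set v; w]).
Proof.
move=> w w' /setP vw; have := vw w; have := vw w'; rewrite !inE !eqxx !orbT.
by case: (eqVneq w' v) => [->|_ /eqP]; case: eqVneq.
Qed.

Lemma card_nbrs K v : simple_graph K -> #|nbrs K v| = degree K v.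
Proof.
move=> sK; rewrite -(card_imset _ (@set2_injr v)); congr #|pred_of_set _|.
apply/setP => e; rewrite inE; apply/imsetP/andP.
  by case=> w; rewrite inE => wK ->; rewrite wK set21.
case=> eK ve; have [w ew] := edge_other_end sK eK ve.
by exists w => //; rewrite inE -ew.
Qed.

Lemma edge_boundaryC E W : simple_graph E -> edge_boundary E (~: W) = edge_boundary E W.
Proof.
move=> sE; congr #|pred_of_set _|; apply/setP => e; rewrite !inE.
case: (boolP (e \in E)) => //= /sE; rewrite -(cardsID W e) setDE.
by case: #|_ :&: W| => [|[|[|?]]]; case: #|_ :&: ~: W| => [|[|[|?]]].
Qed.

Lemma card_setI2 (A : {set T}) u v : u != v ->
  #|A :&: [set u; v]| = (u \in A) + (v \in A).
Proof.
move=> uv; rewrite (cardsD1 u) (cardsD1 v) !inE !eqxx orbT !andbT [v == u]eq_sym uv /=.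
rewrite (_ : _ :\ v = set0) ?cards0 ?addn0 //; apply/setP => w; rewrite !inE.
by case: (w == u); case: (w == v); rewrite ?andbF.
Qed.

Lemma edge_eqE E e u v : simple_graph E -> e \in E -> u != v ->
  (e == [set u; v]) = (u \in e) && (v \in e).
Proof.
move=> sE eE uv; apply/eqP/andP => [->|[ue ve]]; first by rewrite set21 set22.
by apply/esym/eqP; rewrite eqEcard subUset !sub1set ue ve (sE e eE) cards2 uv.
Qed.

Lemma card_starI E u v : simple_graph E -> u != v ->
  #|star E u :&: star E v| = ([set u; v] \in E).
Proof.
move=> sE uv; have [uvE|nuvE] := boolP (_ \in E).
  transitivity #|[set [set u; v]]|; last exact: cards1.
  congr #|pred_of_set _|; apply/setP => e.
  rewrite !inE andbACA andbb; case: (boolP (e \in E)) => [eE|neE].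
    by rewrite (edge_eqE sE eE uv).
  by apply/esym/negbTE; apply: contraNneq neE => ->.
apply/eqP; rewrite cards_eq0 -subset0; apply/subsetP => e.
rewrite !inE andbACA andbb => /andP[eE]; rewrite -(edge_eqE sE eE uv) => /eqP eq_e.
by rewrite -eq_e eE in nuvE.
Qed.

Lemma edge_boundary_edge E u v : simple_graph E -> [set u; v] \in E ->
  (edge_boundary E [set u; v]).+2 = degree E u + degree E v.
Proof.
move=> sE uvE; have uv := simple_edge_neq sE uvE.
rewrite /degree -cardsUI -!/(star E _) card_starI // uvE addn1; congr _.+1.
have <- : #|[set u; v] |: boundary E [set u; v]| = (edge_boundary E [set u; v]).+1.
  by rewrite cardsU1 inE uvE setIid cards2 uv.
congr #|pred_of_set _|; apply/setP => e; rewrite !inE -andb_orr.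
case: (boolP (e \in E)) => [eE|neE]; last by rewrite orbF; apply: contraNF neE => /eqP->.
by rewrite (edge_eqE sE eE uv) card_setI2 //; case: (u \in e) (v \in e) => [] [].
Qed.

Lemma card_bigcup_le_sum (I F : finType) (J : {set I}) (M : I -> {set F}) :
  #|\bigcup_(i in J) M i| <= \sum_(i in J) #|M i|.
Proof.
apply: (big_ind2 (fun (A : {set F}) n => #|A| <= n)); rewrite ?cards0 //.
by move=> A m B n Am Bn; apply: leq_trans (leq_card_setU _ _) (leq_add Am Bn).
Qed.

Lemma edge_boundary_le_sum H W : edge_boundary H W <= \sum_(v in W) degree H v.
Proof.
apply: leq_trans (card_bigcup_le_sum W (star H)); apply: subset_leq_card.
apply/subsetP => e; rewrite inE => /andP[eH /cards1P[v eW]].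
have /setIP[ve vW] : v \in e :&: W by rewrite eW set11.
by apply/bigcupP; exists v; rewrite // inE eH.
Qed.

Lemma card_edges_le E d : simple_graph E -> regular d E -> #|E| <= #|T| * d.
Proof.
move=> sE rE; rewrite -cardsT -sum_nat_const -(eq_bigr _ (fun v _ => rE v)).
apply: leq_trans (card_bigcup_le_sum setT (star E)); apply: subset_leq_card.
apply/subsetP => e eE; have /card_gt0P[v ve] : 0 < #|e| by rewrite (sE e eE).
by apply/bigcupP; exists v; rewrite ?inE // eE.
Qed.

Definition edge_expanding (R : numDomainType) E (size rate : R) : Prop := forall W,
  (#|W|%:R <= size -> rate * #|W|%:R <= (edge_boundary E W)%:R)%R.

Lemma adj_avoiding_connect_sym H S : connect_sym (adj_avoiding H S).
Proof.
apply: sym_connect_sym => x y; rewrite /adj_avoiding /= [in RHS]setUC.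
by case: (x \in S); case: (y \in S).
Qed.

Lemma connect_avoiding_in H S U x y : x \in U -> connect (adj_avoiding H S) x y ->
  (forall u v, u \in U -> v \notin S -> [set u; v] \in H -> v \in U) -> y \in U.
Proof.
move=> xU xy closedU; rewrite -(closed_connect _ xy) //.
apply: (intro_closed (@adj_avoiding_connect_sym H S)) => u v /and3P[_ vS uv] uU.
exact: closedU uU vS uv.
Qed.

Lemma connect_avoiding_notin H S x y :
  x \notin S -> connect (adj_avoiding H S) x y -> y \notin S.
Proof.
move=> xS xy; have := @connect_avoiding_in H S (~: S) x y; rewrite !inE.
by apply=> // u v _ vS _; rewrite inE.
Qed.

Definition connected_in H W : bool :=
  [forall x in W, forall y in W, connect (adj_avoiding H (~: W)) x y].

End Graphs.

(** * Connectivity and hitting times *)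

Section Connectivity.
Local Open Scope nat_scope.
Variable T : finType.
Implicit Types (E G K : {set {set T}}) (S U V : {set T}) (x y : T).
Implicit Types (P Q : pred {set {set T}}).

Lemma min_degree_geS k G K : G \subset K -> min_degree_ge k G -> min_degree_ge k K.
Proof.
move=> GK /forallP dG; apply/forallP => v; apply: leq_trans (dG v) _.
by apply: subset_leq_card; apply/subsetP => e; rewrite !inE => /andP[/(subsetP GK)-> ->].
Qed.

Lemma k_connected_min_degree k K : simple_graph K -> k_connected k K -> min_degree_ge k K.
Proof.
move=> sK /andP[kT /forallP conn]; apply/forallP => v; rewrite leqNgt; apply/negP.
rewrite -card_nbrs // => lt_k; have /implyP/(_ lt_k) := conn (nbrs K v).
have vS : v \in ~: nbrs K v.
  by rewrite !inE; apply/negP => /(simple_edge_neq sK); rewrite eqxx.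
move=> /forall_inP/(_ v vS)/forall_inP conn_v.
have /card_gt0P[y] : 0 < #|~: (v |: nbrs K v)|.
  rewrite -(ltn_add2l #|v |: nbrs K v|) addn0 cardsC.
  by apply: leq_ltn_trans kT; rewrite cardsU1; move: vS; rewrite inE => ->.
rewrite !inE negb_or => /andP[yv yS].
have /conn_v/connectP[[|w p] /=] : y \in ~: nbrs K v by rewrite !inE.
  by move=> _ yv'; rewrite yv' eqxx in yv.
by case/andP=> /and3P[_ wS vw] _; rewrite inE vw in wS.
Qed.

Definition separation K S U V : Prop := [/\ U :|: V = ~: S, [disjoint U & V],
  U != set0, V != set0 & forall x y, x \in U -> y \in V -> [set x; y] \notin K].

Lemma separation_sym K S U V : separation K S U V -> separation K S V U.
Proof.
case=> UV disUV U0 V0 noK; split; rewrite // 1?setUC 1?disjoint_sym //.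
by move=> x y xV yU; rewrite setUC noK.
Qed.

Lemma separationS G K S U V : G \subset K -> separation K S U V -> separation G S U V.
Proof.
move=> GK [UV disUV U0 V0 noK]; split=> // x y xU yV.
by apply: contra (noK x y xU yV); apply: subsetP GK _.
Qed.

Lemma separation_notin K S U V x : separation K S U V -> x \in U -> x \notin S.
Proof. by case=> UV _ _ _ _ xU; rewrite -in_setC -UV inE xU. Qed.

Lemma separation_closed K S U V x y : separation K S U V ->
  x \in U -> y \notin S -> [set x; y] \in K -> y \in U.
Proof.
case=> UV _ _ _ noK xU yS; apply: contraLR => yU; apply: noK => //.
by move: yS; rewrite -in_setC -UV inE (negbTE yU).
Qed.

Lemma not_k_connected_separation k K : k < #|T| -> ~~ k_connected k K ->
  exists S U V, #|S| < k /\ separation K S U V.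
Proof.
move=> kT; rewrite /k_connected kT negb_forall => /existsP[S].
rewrite negb_imply negb_forall_in => /andP[Sk /exists_inP[x xS]].
rewrite negb_forall_in => /exists_inP[y yS nxy]; rewrite !inE in xS yS.
pose U := [set z | connect (adj_avoiding K S) x z].
have US z : z \in U -> z \notin S by rewrite inE; apply: connect_avoiding_notin.
exists S, U, (~: S :\: U); split=> //; split.
- apply/setP => z; rewrite in_setU in_setD in_setC.
  by case: (boolP (z \in U)) => //= /US.
- by rewrite disjoint_sym disjoints_subset; apply/subsetP => z; rewrite !inE => /andP[].
- by apply/set0Pn; exists x; rewrite inE connect0.
- by apply/set0Pn; exists y; rewrite !inE nxy.
- move=> u w uU; rewrite !inE => /andP[xw wS].
  move: (uU); rewrite inE => xu; apply: contra xw => uw.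
  by apply: connect_trans xu (connect1 _); apply/and3P; rewrite (US u uU).
Qed.

Definition forces_hitting E P Q G : bool := ~~ P G &&
  [forall K : {set {set T}}, (G \subset K) && (K \subset E) ==> P K ==> Q K].

Lemma hitting_time_eq E P Q (s : #|E|.-tuple {set T}) m :
  (forall G K, G \subset K -> P G -> P K) -> (forall K, K \subset E -> Q K -> P K) ->
  ordering s -> forces_hitting E P Q (graph_at s m) ->
  hitting_time P s = hitting_time Q s.
Proof.
move=> monoP subQP os /andP[notP /forallP PQ]; apply: eq_find => i.
apply/idP/idP => [Pi|]; last by apply: subQP; apply: graph_at_sub.
apply: (implyP (implyP (PQ _) _)) => //; rewrite graph_at_sub // andbT graph_atS //.
rewrite leqNgt; apply: contra notP => /ltnW /(graph_atS s).
by move/monoP; apply.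
Qed.

End Connectivity.

(** * Small connected sets *)

Section TreeSearch.
Local Open Scope nat_scope.
Variables (T : finType) (E : {set {set T}}) (d : nat).
Hypotheses (sE : simple_graph E) (rE : regular d E).
Implicit Types (A H : {set {set T}}) (W X : {set T}) (Q : seq T) (v w r x y : T).

Definition nth_nbr v j : T := nth v (enum (nbrs E v)) j.

(* Breadth-first search driven by a code: a bit tells whether the head of the
   queue has a further child, whose label is then read, or is finished. *)
Fixpoint tree_search (b : seq bool) (l : seq 'I_d) X Q A : {set T} * {set {set T}} :=
  match b, Q, l with
  | true :: b', v :: _, j :: l' =>
      let w := nth_nbr v j in tree_search b' l' (w |: X) (rcons Q w) ([set v; w] |: A)
  | false :: b', _ :: Q', _ => tree_search b' l X Q' A
  | _, _, _ => (X, A)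
  end.

(* Of a spanning tree of W, only these properties of its edge set are needed. *)
Definition tree_sized A W : bool := (#|A|.+1 == #|W|) && [forall e in A, e \subset W].

Definition search_state H W X Q A : Prop := [/\ X \subset W, {subset Q <= X},
  forall x w, x \in X -> x \notin Q -> w \in W -> [set x; w] \in H -> w \in X,
  A \subset H & tree_sized A X].

Lemma search_state_start H W r : r \in W -> search_state H W [set r] [:: r] set0.
Proof.
move=> rW; split; rewrite ?sub1set ?sub0set //.
- by move=> x; rewrite !inE.
- by move=> x w; rewrite !inE => ->.
- by rewrite /tree_sized cards0 cards1; apply/forall_inP => e; rewrite inE.
Qed.

Lemma search_state_done H W X A r : connected_in H W -> r \in X ->
  search_state H W X [::] A -> X = W.
Proof.
move=> connW rX [XW _ closedX _ _]; apply/eqP; rewrite eqEsubset XW.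
apply/subsetP => y yW.
have /connect_avoiding_in := forall_inP (forall_inP connW r (subsetP XW r rX)) y yW.
by apply=> // x w xX; rewrite inE negbK; apply: closedX.
Qed.

Lemma search_state_next H W X Q A v : search_state H W X (v :: Q) A ->
  (forall w, w \in W -> w \notin X -> [set v; w] \notin H) -> search_state H W X Q A.
Proof.
case=> XW QX closedX AH treeA no_child; split=> //.
  by move=> x xQ; apply: QX; rewrite inE xQ orbT.
move=> x w xX xQ wW xw; have [xv|xv] := eqVneq x v.
  by apply: contraLR xw => wX; rewrite xv no_child.
by apply: closedX xw => //; rewrite inE negb_or xv.
Qed.

Lemma search_state_visit H W X Q A v w : search_state H W X (v :: Q) A ->
  w \in W -> w \notin X -> [set v; w] \in H ->
  search_state H W (w |: X) (rcons (v :: Q) w) ([set v; w] |: A).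
Proof.
case=> XW QX closedX AH /andP[/eqP cardA /forall_inP AX] wW wX vw.
have vX : v \in X by apply: QX; rewrite inE eqxx.
split; rewrite ?subUset ?sub1set ?wW ?vw //.
- move=> x; rewrite mem_rcons inE => /predU1P[->|/QX xX]; first exact: setU11.
  exact: setU1r.
- move=> x y; rewrite in_setU1 mem_rcons [x \in w :: _]inE negb_or.
  move=> /predU1P[->|xX /andP[_ xQ] yW xy]; first by rewrite eqxx.
  by apply: setU1r; apply: closedX xy.
- have vwA : [set v; w] \notin A.
    by apply: contra wX => /AX/subsetP/(_ w); rewrite set22; apply.
  rewrite /tree_sized !cardsU1 vwA wX -cardA eqxx; apply/forall_inP => e.
  rewrite in_setU1 => /predU1P[->|/AX eX]; last exact: subset_trans eX (subsetUr _ _).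
  by rewrite subUset !sub1set setU11 setU1r.
Qed.

Lemma nth_nbr_surj v w : [set v; w] \in E -> exists j : 'I_d, nth_nbr v j = w.
Proof.
move=> vw; have wv : w \in nbrs E v by rewrite inE.
have index_lt : index w (enum (nbrs E v)) < d.
  by rewrite -(rE v) -card_nbrs // cardE index_mem mem_enum.
by exists (Ordinal index_lt); rewrite /nth_nbr nth_index ?mem_enum.
Qed.

Lemma tree_search_complete H W r X Q A : H \subset E -> connected_in H W -> r \in X ->
  search_state H W X Q A ->
  exists b l A', [/\ size b = 2 * (#|W| - #|X|) + size Q, size l = #|W| - #|X|,
    tree_search b l X Q A = (W, A'), A' \subset H & tree_sized A' W].
Proof.
move=> HE connW; have [n] := ubnP (2 * (#|W| - #|X|) + size Q).
elim: n => // n IHn in X Q A *; case: Q => [|v Q] /= lt_n rX state.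
  have eqXW := search_state_done connW rX state; case: state => _ _ _ AH.
  by rewrite eqXW subnn => treeA; exists [::], [::], A.
have [/exists_inP[w wW /andP[wX vw]]|no_child] :=
    boolP [exists w in W, (w \notin X) && ([set v; w] \in H)]; last first.
  have [||b [l [A' [sb sl eA AH treeA]]]] := IHn X Q A _ rX (search_state_next state _).
  - by move: lt_n; lia.
  - move=> w wW wX; apply: contra no_child => vw.
    by apply/exists_inP; exists w; rewrite ?wX.
  - by exists (false :: b), l, A'; split; rewrite //= sb; lia.
have ltXW : #|X| < #|W|.
  case: state => XW _ _ _ _; apply: proper_card; rewrite properE XW.
  by apply/subsetPn; exists w.
have cardX : #|w |: X| = #|X|.+1 by rewrite cardsU1 wX.
have [||b [l [A' [sb sl eA AH treeA]]]] :=
  IHn _ _ _ _ _ (search_state_visit state wW wX vw).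
- by rewrite size_rcons cardX /=; move: lt_n ltXW; lia.
- exact: setU1r.
have [j vjw] := nth_nbr_surj (subsetP HE _ vw).
exists (true :: b), (j :: l), A'; split; rewrite //= ?vjw //.
- by rewrite sb size_rcons cardX /=; move: ltXW; lia.
- by rewrite sl cardX; move: ltXW; lia.
Qed.

Definition tree_code m : finType := ((2 * m).-1.-tuple bool * m.-1.-tuple 'I_d)%type.

Definition decode_tree m r (c : tree_code m) : {set T} * {set {set T}} :=
  tree_search c.1 c.2 [set r] [:: r] set0.

Lemma card_tree_code m : #|{: tree_code m}| = 2 ^ (2 * m).-1 * d ^ m.-1.
Proof. by rewrite card_prod !card_tuple card_bool card_ord. Qed.

Lemma connected_in_decode_tree H W : H \subset E -> W != set0 -> connected_in H W ->
  exists r (c : tree_code #|W|) A,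
    [/\ decode_tree r c = (W, A), A \subset H & tree_sized A W].
Proof.
move=> HE /set0Pn[r rW] connW; have W_gt0 : 0 < #|W| by apply/card_gt0P; exists r.
have [b [l [A [sb sl eA AH treeA]]]] :=
  tree_search_complete HE connW (set11 r) (search_state_start H rW).
have size_b : size b == (2 * #|W|).-1 by rewrite sb cards1 /=; move: W_gt0; lia.
have size_l : size l == #|W|.-1 by rewrite sl cards1; move: W_gt0; lia.
by exists r, (Tuple size_b, Tuple size_l), A.
Qed.

End TreeSearch.

Section SmallTraps.
Variables (R : realFieldType) (T : finType) (E : {set {set T}}) (d k : nat).
Hypotheses (sE : simple_graph E) (rE : regular d E).
Variables (q x : R).
Hypotheses (q_prob : 0 <= q <= 1) (x_unit : 0 < x <= 1).
Implicit Types (A H : {set {set T}}) (W : {set T}).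

Lemma bpr_connected_set m (B : {set T} -> pred {set {set T}}) (p : R) :
  (0 < m)%N -> 0 <= p ->
  (forall A W, A \subset E -> tree_sized A W -> #|W| = m ->
     bpr E q (fun H => (A \subset H) && B W H) <= p) ->
  bpr E q (fun H => [exists (W : {set T} | #|W| == m), connected_in H W && B W H])
  <= #|T|%:R * (2 ^ (2 * m).-1 * d ^ m.-1)%:R * p.
Proof.
move=> m_gt0 p_ge0 tree_le.
pose tree (rc : T * tree_code d m) := decode_tree E rc.1 rc.2.
pose proper_tree rc := [&& (tree rc).2 \subset E, tree_sized (tree rc).2 (tree rc).1 &
  #|(tree rc).1| == m].
apply: (@le_trans _ _ (bpr E q (fun H => [exists (rc | proper_tree rc),
    ((tree rc).2 \subset H) && B (tree rc).1 H]))).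
  apply: ler_bpr => // H HE /exists_inP[W /eqP cardW /andP[connW BW]].
  have W0 : W != set0 by rewrite -card_gt0 cardW.
  have [r [c [A [eA AH treeA]]]] := connected_in_decode_tree sE rE HE W0 connW.
  rewrite cardW in c eA; apply/existsP; exists (r, c).
  by rewrite /proper_tree /tree eA /= AH BW cardW treeA (subset_trans AH HE) eqxx.
apply: le_trans (bpr_exists _ q_prob _ _) _.
apply: (@le_trans _ _ (\sum_(rc | proper_tree rc) p)).
  by apply: ler_sum => rc /and3P[AE treeA /eqP cardW]; apply: tree_le.
rewrite sumr_const -[_ *+ _]mulr_natl ler_wpM2r //.
by rewrite -card_tree_code -natrM ler_nat -card_prod max_card.
Qed.

(* Markov's inequality for x ^+ edge_boundary H W. *)
Lemma bpr_superset_boundary_le A W b : A \subset E -> (forall e, e \in A -> e \subset W) ->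
  bpr E q (fun H => (A \subset H) && (edge_boundary H W <= b)%N)
  <= (1 - q) ^+ #|A| * (q + (1 - q) * x) ^+ edge_boundary E W * x^-1 ^+ b.
Proof.
move=> AE AW; have /andP[x_gt0 x_le1] := x_unit.
have disA : [disjoint A & boundary E W].
  rewrite disjoints_subset; apply/subsetP => e eA; rewrite !inE.
  by rewrite (subsetP AE) // (setIidPl (AW _ eA)) (sE (subsetP AE _ eA)).
rewrite -(bexp_superset_expr_setI q x AE (boundary_sub E W) disA) mulrC -bexpZ.
apply: ler_bexp => // H HE; rewrite boundaryI // -mulnb natrM mulrCA ler_wpM2l //.
case: leqP => [le_b|_]; last by rewrite mulr_ge0 // exprn_ge0 // ?invr_ge0 ltW.
by rewrite exprVn ler_pdivlMl ?exprn_gt0 // mulr1 ler_wiXn2l // ltW.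
Qed.

Definition small_trap (L : R) H W : bool := [&& (1 < #|W|)%N, #|W|%:R <= L,
  connected_in H W & (edge_boundary H W <= k * #|W|)%N].

Definition has_small_trap L H : bool := [exists W, small_trap L H W].

Lemma bpr_has_small_trap (L g : R) : 0 <= g ->
  (forall W, #|W|%:R <= L -> (q + (1 - q) * x) ^+ edge_boundary E W <= g ^+ #|W|) ->
  bpr E q (has_small_trap L) <= \sum_(m < #|T|.+1 | (1 < m)%N)
    #|T|%:R * (2 ^ (2 * m).-1 * d ^ m.-1)%:R * ((1 - q) ^+ m.-1 * (g * x^-1 ^+ k) ^+ m).
Proof.
move=> g_ge0 boundary_le.
have [/andP[q_ge0 q_le1] /andP[x_gt0 _]] := (q_prob, x_unit).
pose bounded W H := (#|W|%:R <= L) && (edge_boundary H W <= k * #|W|)%N.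
apply: (@le_trans _ _ (bpr E q (fun H => [exists (m : 'I_#|T|.+1 | (1 < m)%N),
    [exists (W : {set T} | #|W| == m), connected_in H W && bounded W H]]))).
  apply: ler_bpr => // H HE /existsP[W /and4P[card_gt1 card_le connW le_k]].
  have card_lt : (#|W| < #|T|.+1)%N by rewrite ltnS max_card.
  apply/exists_inP; exists (Ordinal card_lt) => //.
  by apply/exists_inP; exists W; rewrite // connW /bounded card_le.
apply: le_trans (bpr_exists _ q_prob _ _) _; apply: ler_sum => m m_gt1.
apply: bpr_connected_set; first exact: ltnW.
  by rewrite mulr_ge0 // exprn_ge0 ?subr_ge0 // mulr_ge0 // exprn_ge0 // ?invr_ge0 ltW.
move=> A W AE treeA cardW; case: (boolP (#|W|%:R <= L)) => [small|large]; last first.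
  rewrite (eq_bpr _ (Q := xpred0)) => [|H _].
    rewrite [bpr _ _ _]bexp_cst mulr_ge0 // exprn_ge0 ?subr_ge0 //.
    by rewrite mulr_ge0 // exprn_ge0 // ?invr_ge0 ltW.
  by rewrite /bounded (negbTE large) andbF.
under eq_bpr => H _ do rewrite /bounded small /=.
have [/eqP cardA /forall_inP AW] := andP treeA.
apply: le_trans (bpr_superset_boundary_le _ AE AW) _.
rewrite -[#|A|]/(#|A|.+1.-1) cardA cardW exprMn -exprM -mulrA.
rewrite ler_wpM2l ?exprn_ge0 ?subr_ge0 //.
rewrite ler_wpM2r ?exprn_ge0 ?invr_ge0 ?(ltW x_gt0) //.
by rewrite -[in leRHS]cardW boundary_le.
Qed.

Definition adjacent_low_degrees H : bool :=
  [exists e in E, [forall v in e, (degree H v < k)%N]].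

Lemma bpr_adjacent_low_degrees : bpr E q adjacent_low_degrees
  <= #|E|%:R * ((q + (1 - q) * x) ^+ (2 * d.-1) * x^-1 ^+ (2 * k)).
Proof.
apply: le_trans (bpr_exists _ q_prob _ _) _.
rewrite mulr_natl -sumr_const; apply: ler_sum => e eE.
have /eqP/cards2P[u [v [uv def_e]]] := sE eE.
have boundary_e : edge_boundary E e = (2 * d.-1)%N.
  have := edge_boundary_edge sE (u := u) (v := v); rewrite -def_e !rE => /(_ eE).
  by case: d => [|d']; lia.
apply: (@le_trans _ _ (bpr E q (fun H =>
    (set0 \subset H) && (edge_boundary H e <= 2 * k)%N))).
  apply: ler_bpr => // H HE /forall_inP low; rewrite sub0set /=.
  apply: leq_trans (edge_boundary_le_sum H e) _; rewrite -(sE eE) -sum_nat_const.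
  by apply: leq_sum => w we; apply/ltnW/low.
apply: le_trans (bpr_superset_boundary_le _ (sub0set E) _) _ => [f|]; first by rewrite inE.
by rewrite cards0 expr0 mul1r boundary_e.
Qed.

End SmallTraps.

(** * Isolated vertices *)

Lemma bpr_second_moment (R : realFieldType) (F : finType) (E : {set F}) (q : R)
    (X : {set F} -> R) (P : pred {set F}) :
  0 <= q <= 1 -> bexp E q X != 0 -> (forall H : {set F}, H \subset E -> P H -> X H = 0) ->
  bpr E q P <= bexp E q (fun H => X H ^+ 2) / bexp E q X ^+ 2 - 1.
Proof.
move=> q_prob; set mu := bexp E q X => mu_neq0 X_eq0.
have -> : bexp E q (fun H => X H ^+ 2) / mu ^+ 2 - 1
    = bexp E q (fun H => mu^-1 ^+ 2 * X H ^+ 2 + (- 2 * mu^-1 * X H + 1)).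
  by rewrite !bexpD !bexpZ bexp_cst -/mu exprVn; field.
apply: ler_bexp => // H HE.
have -> : mu^-1 ^+ 2 * X H ^+ 2 + (- 2 * mu^-1 * X H + 1)
    = (mu^-1 * X H - 1) ^+ 2 by ring.
case: (boolP (P H)) => [/X_eq0->//|_]; last exact: sqr_ge0.
by rewrite mulr0 sub0r sqrrN expr1n.
Qed.

Section IsolatedVertices.
Variables (R : realFieldType) (T : finType) (E : {set {set T}}) (d : nat).
Hypotheses (sE : simple_graph E) (rE : regular d E).
Variable q : R.
Hypothesis q_unit : 0 < q <= 1.
Implicit Types (H : {set {set T}}) (u v : T).

Let q_prob : 0 <= q <= 1.
Proof. by case/andP: q_unit => /ltW-> ->. Qed.

Let exprq_ge0 n : 0 <= q ^+ n.
Proof. by rewrite exprn_ge0 //; case/andP: q_prob. Qed.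

Definition isolated_count H : R := \sum_v [disjoint star E v & H]%:R.

Lemma isolated_count_eq0 H : H \subset E -> min_degree_ge 1 H -> isolated_count H = 0.
Proof.
move=> HE /forallP deg_gt0; apply: big1 => v _.
have /card_gt0P[e] := deg_gt0 v; rewrite inE => /andP[eH ve].
case: (boolP [disjoint _ & _]) => // /pred0P/(_ e).
by rewrite /= inE (subsetP HE) // ve eH.
Qed.

Lemma bexp_isolated_count : bexp E q isolated_count = #|T|%:R * q ^+ d.
Proof.
rewrite bexp_sum mulr_natl -sumr_const; apply: eq_bigr => v _.
by rewrite [LHS]bpr_absent ?star_sub // [#|_|]rE.
Qed.

Lemma exprn_card_starU u v : q ^+ #|star E u :|: star E v| <=
  q ^+ (2 * d) + (u == v)%:R * q ^+ d + ([set u; v] \in E)%:R * q ^+ (2 * d).-1.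
Proof.
have card_star w : #|star E w| = d by exact: rE.
have [->|uv] := eqVneq u v.
  by rewrite setUid card_star mul1r addrAC lerDr addr_ge0 // mulr_ge0.
rewrite cardsU !card_star mul0r addr0 card_starI // addnn -mul2n.
by case: (_ \in E); rewrite ?subn1 ?subn0 ?mul1r ?mul0r ?addr0 // lerDr.
Qed.

Lemma sum_exprn_card_starU u : \sum_v q ^+ #|star E u :|: star E v| <=
  #|T|%:R * q ^+ (2 * d) + q ^+ d + d%:R * q ^+ (2 * d).-1.
Proof.
apply: le_trans (ler_sum _ (fun v _ => exprn_card_starU u v)) _.
rewrite !big_split /= sumr_const mulr_natl -!mulr_suml -!natr_sum !lerD //.
  rewrite -[leRHS]mul1r ler_wpM2r // lern1.
  by rewrite (bigD1 u) //= eqxx big1 // => v; rewrite eq_sym => /negbTE->.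
rewrite ler_wpM2r // ler_nat -(rE u) -card_nbrs // -sum1_card [leqRHS]big_mkcond /=.
by apply: leq_sum => v _; rewrite inE; case: ifP.
Qed.

Lemma bexp_isolated_count_sqr : bexp E q (fun H => isolated_count H ^+ 2) <=
  #|T|%:R * (#|T|%:R * q ^+ (2 * d) + q ^+ d + d%:R * q ^+ (2 * d).-1).
Proof.
apply: (@le_trans _ _ (\sum_u \sum_v q ^+ #|star E u :|: star E v|)); last first.
  rewrite mulr_natl -sumr_const; apply: ler_sum => u _.
  exact: sum_exprn_card_starU.
under eq_bexp => H _.
  rewrite expr2 big_distrlr; under eq_bigr => u _ do under eq_bigr => v _ do
    rewrite /= -natrM mulnb -!setI_eq0 -setU_eq0 -setIUl setI_eq0.
  over.
rewrite bexp_sum; apply: ler_sum => u _; rewrite bexp_sum; apply: ler_sum => v _.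
by rewrite [leLHS]bpr_absent // subUset !star_sub.
Qed.

Lemma bpr_min_degree_gt0 : (0 < d)%N -> (0 < #|T|)%N ->
  bpr E q (min_degree_ge 1) <= (#|T|%:R * q ^+ d)^-1 + d%:R / (#|T|%:R * q).
Proof.
move=> d_gt0 T_gt0; have [q_gt0 _] := andP q_unit.
have n_gt0 : 0 < #|T|%:R :> R by rewrite ltr0n.
have mu_gt0 : 0 < #|T|%:R * q ^+ d by rewrite mulr_gt0 // exprn_gt0.
apply: le_trans (bpr_second_moment q_prob _ isolated_count_eq0) _.
  by rewrite bexp_isolated_count gt_eqF.
rewrite bexp_isolated_count lerBlDr ler_pdivrMr ?exprn_gt0 //.
apply: le_trans bexp_isolated_count_sqr _; rewrite le_eqVlt; apply/predU1P; left.
have -> : q ^+ (2 * d) = q ^+ d * q ^+ d by rewrite mul2n -addnn exprD.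
have -> : q ^+ (2 * d).-1 = q ^+ d * q ^+ d / q.
  apply: (canRL (mulfK (lt0r_neq0 q_gt0))).
  by rewrite -exprSr prednK ?muln_gt0 // mul2n -addnn exprD.
by field; rewrite !gt_eqF ?exprn_gt0.
Qed.

End IsolatedVertices.

(** * Sprinkling across a cut *)

Section DisjointFamilies.
Variables (F I : finType) (J : {set I}) (M : I -> {set F}).
Hypothesis disM : {in J &, forall u v, u != v -> [disjoint M u & M v]}.

Lemma card_disjoint_bigcup (A : {set I}) : A \subset J ->
  #|\bigcup_(v in A) M v| = (\sum_(v in A) #|M v|)%N.
Proof.
move=> /subsetP AJ; rewrite big_mkcond -sum1_card.
rewrite (@partition_disjoint_bigcup _ _ _ _ _ (fun v => if v \in A then M v else set0)).
  rewrite [RHS]big_mkcond; apply: eq_bigr => v _; rewrite sum1_card.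
  by case: ifP; rewrite ?cards0.
move=> u v uv; rewrite -setI_eq0; case: ifP => [uA|]; last by rewrite set0I.
by case: ifP => [vA|]; rewrite ?setI0 // setI_eq0 disM ?AJ.
Qed.

Lemma bigcupl_disjointP (A : {set I}) (U : {set F}) :
  reflect (forall v, v \in A -> [disjoint M v & U]) [disjoint \bigcup_(v in A) M v & U].
Proof.
rewrite disjoint_sym; apply: (iffP bigcup_disjointP) => disU v /disU.
  by rewrite disjoint_sym.
by rewrite disjoint_sym.
Qed.

Lemma bexp_prod_absent (R : realFieldType) (E : {set F}) (q : R) (a b : I -> R) :
  {in J, forall v, M v \subset E} ->
  bexp E q (fun H => \prod_(v in J) (a v * [disjoint M v & H]%:R + b v))
  = \prod_(v in J) (a v * q ^+ #|M v| + b v).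
Proof.
move=> ME; transitivity (bexp E q (fun H => \sum_(A in powerset J)
    (\prod_(v in J) (if v \in A then a v else b v)) *
    [disjoint \bigcup_(v in A) M v & H]%:R)).
  apply: eq_bexp => H HE; rewrite -sum_powerset_prod; apply: eq_bigr => A.
  rewrite powersetE => AJ; have [/bigcupl_disjointP disH|] := boolP [disjoint _ & H].
    rewrite mulr1; apply: eq_bigr => v vJ; case: ifP => // /disH ->.
    by rewrite mulr1.
  have [/exists_inP[v vA meets] _|] := boolP [exists v in A, ~~ [disjoint M v & H]].
    by rewrite mulr0 (bigD1 v) ?(subsetP AJ) //= vA (negbTE meets) mulr0 mul0r.
  rewrite negb_exists_in => /forall_inP none /bigcupl_disjointP[] v /none.
  by rewrite negbK.
rewrite bexp_sum -sum_powerset_prod; apply: eq_bigr => A; rewrite powersetE => AJ.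
rewrite bexpZ [X in _ * X]bpr_absent; last by apply/bigcupsP => v /(subsetP AJ)/ME.
rewrite card_disjoint_bigcup // -prodrXr -(prod_if_subset _ AJ) -big_split /=.
by apply: eq_bigr => v _; case: ifP; rewrite ?mulr1.
Qed.

End DisjointFamilies.

Section TwoRounds.
Variables (R : realFieldType) (F I : finType) (E : {set F}) (J : {set I}).
Variables (B : {set F}) (M D : I -> {set F}).
Hypotheses (BE : B \subset E) (ME : {in J, forall v, M v \subset E})
  (DE : {in J, forall v, D v \subset E})
  (disM : {in J &, forall u v, u != v -> [disjoint M u & M v]})
  (disD : {in J &, forall u v, u != v -> [disjoint D u & D v]})
  (disB : {in J, forall v, [disjoint B & M v]}).
Variables q1 q2 : R.
Hypotheses (q1_prob : 0 <= q1 <= 1) (q2_prob : 0 <= q2 <= 1).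

Lemma bpr_absent_or (H1 : {set F}) :
  bpr E q2 (fun H2 => [disjoint B & H2] &&
    [forall v in J, [disjoint D v & H1] || [disjoint M v & H2]])
  <= q2 ^+ #|B| *
     \prod_(v in J) ((1 - q2 ^+ #|M v|) * [disjoint D v & H1]%:R + q2 ^+ #|M v|).
Proof.
pose A := [set v in J | ~~ [disjoint D v & H1]].
have AJ : A \subset J by apply/subsetP => v; rewrite inE => /andP[].
have AJ_in := subsetP AJ.
apply: (@le_trans _ _ (bpr E q2 (fun H2 => [disjoint B :|: \bigcup_(v in A) M v & H2]))).
  apply: ler_bpr => // H2 _ /andP[disBH /forall_inP avoid].
  rewrite -setI_eq0 setIUl setU_eq0 !setI_eq0 disBH /=; apply/bigcupl_disjointP => v.
  by rewrite inE => /andP[/avoid/orP[->|->]].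
rewrite bpr_absent ?subUset ?BE /=; last by apply/bigcupsP => v /AJ_in/ME.
rewrite cardsU (_ : B :&: _ = set0) ?cards0 ?subn0; last first.
  by apply/eqP; rewrite setI_eq0; apply/bigcup_disjointP => v /AJ_in/disB.
rewrite (card_disjoint_bigcup disM AJ) exprD -prodrXr -(prod_if_subset _ AJ).
rewrite le_eqVlt; apply/predU1P; left; congr (_ * _); apply: eq_bigr => v vJ.
by rewrite inE vJ; case: [disjoint _ & _]; rewrite /= ?mulr1 ?subrK // mulr0 add0r.
Qed.

Lemma bpr_two_rounds :
  bexp E q1 (fun H1 => bpr E q2 (fun H2 => [disjoint B & H2] &&
    [forall v in J, [disjoint D v & H1] || [disjoint M v & H2]]))
  <= q2 ^+ #|B| * \prod_(v in J) (q2 ^+ #|M v| + (1 - q2 ^+ #|M v|) * q1 ^+ #|D v|).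
Proof.
apply: le_trans (ler_bexp q1_prob (fun H1 _ => bpr_absent_or H1)) _.
rewrite bexpZ bexp_prod_absent // le_eqVlt; apply/predU1P; left; congr (_ * _).
by apply: eq_bigr => v _; rewrite addrC.
Qed.

End TwoRounds.

Section EdgesTo.
Variables (T : finType) (E : {set {set T}}).
Implicit Types (u v z : T) (Z : {set T}) (e : {set T}) (H : {set {set T}}).

Definition edges_to v Z : {set {set T}} := [set [set v; z] | z in nbrs E v :&: Z].

Lemma edges_toP v Z e :
  reflect (exists z, [/\ z \in Z, e = [set v; z] & e \in E]) (e \in edges_to v Z).
Proof.
apply: (iffP imsetP) => [[z]|[z [zZ ->]] eE].
  by rewrite !inE => /andP[eE zZ] ->; exists z.
by exists z => //; rewrite !inE eE zZ.
Qed.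

Lemma edges_to_sub v Z : edges_to v Z \subset E.
Proof. by apply/subsetP => e /edges_toP[z []]. Qed.

Lemma card_edges_to v Z : #|edges_to v Z| = #|nbrs E v :&: Z|.
Proof. exact: card_imset (@set2_injr _ v). Qed.

Lemma card_edges_to_le v Z : simple_graph E -> (#|edges_to v Z| <= degree E v)%N.
Proof.
by move=> sE; rewrite card_edges_to -card_nbrs // subset_leq_card // subsetIl.
Qed.

Lemma edges_to_disjoint u v Z Z' : u != v -> v \notin Z ->
  [disjoint edges_to u Z & edges_to v Z'].
Proof.
move=> uv vZ; rewrite disjoints_subset; apply/subsetP => e /edges_toP[z [zZ eq_e _]].
rewrite inE; apply/edges_toP => -[z' [_ eq_e' _]].
have : v \in [set u; z] by rewrite -eq_e eq_e' set21.
by rewrite !inE eq_sym (negbTE uv) /= => /eqP vz; rewrite vz zZ in vZ.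
Qed.

Lemma separation_edges_to K S U V H Z v :
  separation K S U V -> H \subset K -> Z \subset U -> v \notin S ->
  ~~ [disjoint edges_to v Z & H] -> v \in U.
Proof.
move=> sep /subsetP HK /subsetP ZU vS /pred0Pn[e /andP[/edges_toP[z [zZ eq_e _]] eH]].
by apply: (separation_closed sep (ZU z zZ) vS); rewrite setUC -eq_e HK.
Qed.

End EdgesTo.

Section Cut.
Variables (T : finType) (E : {set {set T}}) (X Y J : {set T}).
Implicit Types (u v : T) (e : {set T}) (H : {set {set T}}).

Definition prefers_X v : bool := (#|edges_to E v Y| < #|edges_to E v X|)%N.

Definition minor v : {set {set T}} := edges_to E v (if prefers_X v then Y else X).

Definition major v : {set {set T}} := edges_to E v (if prefers_X v then X else Y).

Definition crossing : {set {set T}} :=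
  [set e in E | (e :&: X != set0) && (e :&: Y != set0)].

Definition link_edges : nat := (#|crossing| + \sum_(v in J) #|minor v|)%N.

(* A vertex of J has to be linked to the side it prefers by H1, and to the other
   side by H2. *)
Definition unlinked H1 H2 : bool := [disjoint crossing & H2] &&
  [forall v in J, [disjoint major v & H1] || [disjoint minor v & H2]].

Lemma separation_unlinked K S U V H1 H2 :
  separation K S U V -> simple_graph E -> H1 \subset K -> H2 \subset K ->
  X \subset U -> Y \subset V -> [disjoint J & S] -> unlinked H1 H2.
Proof.
move=> sep sE H1K H2K XU YV disJS.
have [_ disUV _ _ noK] := sep.
have notU v : v \in V -> v \notin U by move=> vV; rewrite (disjointFl disUV vV).
apply/andP; split.
  rewrite disjoints_subset; apply/subsetP => e; rewrite inE => /and3P[eE].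
  move=> /set0Pn[x /setIP[xe xX]] /set0Pn[y /setIP[ye yY]].
  rewrite in_setC; apply/negP => eH2.
  have xy : x != y by apply: contraTneq (subsetP XU x xX) => ->; apply/notU/(subsetP YV).
  have /eqP eq_e : e == [set x; y] by rewrite (edge_eqE sE eE xy) xe ye.
  by have := noK x y (subsetP XU x xX) (subsetP YV y yY); rewrite -eq_e (subsetP H2K).
apply/forall_inP => v vJ; apply/norP => -[].
have vS : v \notin S by rewrite (disjointFr disJS vJ).
have vU H : H \subset K -> ~~ [disjoint edges_to E v X & H] -> v \in U.
  by move=> HK; apply: separation_edges_to sep HK XU vS.
have vV H : H \subset K -> ~~ [disjoint edges_to E v Y & H] -> v \in V.
  by move=> HK; apply: separation_edges_to (separation_sym sep) HK YV vS.
rewrite /major /minor; case: ifP => _ to_major to_minor.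
  by have := notU v (vV _ H2K to_minor); rewrite (vU _ H1K to_major).
by have := notU v (vV _ H1K to_major); rewrite (vU _ H2K to_minor).
Qed.

Variables (d k : nat) (S : {set T}).
Hypotheses (sE : simple_graph E) (rE : regular d E).
Hypotheses (disXY : [disjoint X & Y]) (disXJ : [disjoint X & J])
  (disYJ : [disjoint Y & J]) (XYJS : X :|: Y :|: J :|: S = [set: T])
  (Sk : (#|S| < k)%N) (indJ : {in J &, forall u v, [set u; v] \notin E}).

Lemma crossing_sub : crossing \subset E.
Proof. by apply/subsetP => e; rewrite inE => /andP[]. Qed.

Lemma minor_disjoint : {in J &, forall u v, u != v -> [disjoint minor u & minor v]}.
Proof.
move=> u v uJ vJ uv; apply: edges_to_disjoint => //.
by case: ifP => _; [rewrite (disjointFl disYJ vJ) | rewrite (disjointFl disXJ vJ)].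
Qed.

Lemma major_disjoint : {in J &, forall u v, u != v -> [disjoint major u & major v]}.
Proof.
move=> u v uJ vJ uv; apply: edges_to_disjoint => //.
by case: ifP => _; [rewrite (disjointFl disXJ vJ) | rewrite (disjointFl disYJ vJ)].
Qed.

Lemma crossing_minor_disjoint : {in J, forall v, [disjoint crossing & minor v]}.
Proof.
move=> v vJ; rewrite disjoint_sym disjoints_subset; apply/subsetP => e.
move=> /edges_toP[z [_ -> _]]; rewrite !inE; apply/negP.
case/and3P=> _ /set0Pn[x /setIP[xe xX]] /set0Pn[y /setIP[ye yY]].
move: xe ye; rewrite !inE => /orP[]/eqP xz /orP[]/eqP yz; subst.
- by rewrite (disjointFl disXJ vJ) in xX.
- by rewrite (disjointFl disXJ vJ) in xX.
- by rewrite (disjointFl disYJ vJ) in yY.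
- by rewrite (disjointFr disXY xX) in yY.
Qed.

Definition majority_side : {set T} := X :|: [set v in J | prefers_X v].

Lemma sub_majority_sideC : Y \subset ~: majority_side.
Proof.
apply/subsetP => y yY; rewrite !inE negb_or (disjointFl disXY yY).
by rewrite (disjointFr disYJ yY).
Qed.

Lemma boundary_majority_side e : e \in boundary E majority_side ->
  e \in crossing :|: \bigcup_(v in J) minor v :|: \bigcup_(s in S) star E s.
Proof.
move=> eP; have eE : e \in E by apply: subsetP eP; apply: boundary_sub.
have [u [v [eq_e uP vP]]] := boundary_ends sE eP.
have [ue ve] : u \in e /\ v \in e by rewrite eq_e set21 set22.
have in_star w : w \in e -> w \in S -> e \in \bigcup_(s in S) star E s.
  by move=> we wS; apply/bigcupP; exists w; rewrite // inE eE.
rewrite in_setU; have [/(in_star u ue)->|uS] := boolP (u \in S); first exact: orbT.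
have [/(in_star v ve)->|vS] := boolP (v \in S); first exact: orbT.
apply/orP; left; rewrite in_setU.
move: vP; rewrite !inE negb_or => /andP[vX].
have := in_setT v; rewrite -XYJS !in_setU (negbTE vX) (negbTE vS) orbF orFb.
case: (boolP (v \in J)) => [vJ _|_]; last rewrite orbF => vY _.
  rewrite andTb => v_prefers_Y.
  move: uP; rewrite !inE => /orP[uX|/andP[uJ _]]; last first.
    by have := indJ uJ vJ; rewrite -eq_e eE.
  apply/orP; right; apply/bigcupP; exists v => //.
  by apply/edges_toP; exists u; rewrite (negbTE v_prefers_Y) setUC.
move: uP; rewrite !inE eE /= => /orP[uX|/andP[uJ u_prefers_X]].
  apply/orP; left; apply/andP.
  by split; apply/set0Pn; [exists u|exists v]; rewrite inE ?ue ?ve.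
apply/orP; right; apply/bigcupP; exists u => //.
by apply/edges_toP; exists v; rewrite u_prefers_X.
Qed.

Lemma edge_boundary_majority_side :
  (edge_boundary E majority_side <= link_edges + k * d)%N.
Proof.
apply: leq_trans (subset_leq_card (introT subsetP boundary_majority_side)) _.
apply: leq_trans (leq_card_setU _ _) _; apply: leq_add.
  apply: leq_trans (leq_card_setU _ _) _.
  by rewrite (card_disjoint_bigcup minor_disjoint (subxx J)).
apply: leq_trans (card_bigcup_le_sum _ _) _.
by rewrite (eq_bigr _ (fun s _ => rE s)) sum_nat_const leq_mul2r ltnW ?orbT.
Qed.

Variable R : realFieldType.

Lemma link_edges_ge (c : R) : 0 <= c -> (#|X| <= #|Y|)%N ->
  edge_expanding E (#|T|%:R / 2) c ->
  c * #|X|%:R <= (link_edges + k * d)%:R.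
Proof.
move=> c_ge0 XY expansion; set P := majority_side.
have [U [XU U_half boundaryU]] : exists U : {set T}, [/\ (#|X| <= #|U|)%N,
    (#|U| * 2 <= #|T|)%N & edge_boundary E U = edge_boundary E P].
  have [small|large] := leqP (#|P| * 2)%N #|T|.
    by exists P; split=> //; apply/subset_leq_card/subsetUl.
  exists (~: P); rewrite edge_boundaryC //; split=> //.
    exact: leq_trans XY (subset_leq_card sub_majority_sideC).
  by have := cardsC P; lia.
apply: (@le_trans _ _ (edge_boundary E U)%:R).
  apply: (@le_trans _ _ (c * #|U|%:R)); first by rewrite ler_wpM2l // ler_nat.
  by apply: expansion; rewrite ler_pdivlMr // -natrM ler_nat.
by rewrite boundaryU ler_nat edge_boundary_majority_side.
Qed.

Hypothesis kd : (2 * k <= d)%N.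

Lemma card_minor_le v : (#|minor v| <= d)%N.
Proof. by rewrite -(rE v); apply: card_edges_to_le. Qed.

(* All but fewer than k <= d/2 neighbours of v lie in X or in Y. *)
Lemma card_major_ge v : v \in J -> (d <= 4 * #|major v|)%N.
Proof.
move=> vJ; have : (d <= #|edges_to E v X| + #|edges_to E v Y| + #|S|)%N.
  rewrite !card_edges_to -(rE v) -card_nbrs //.
  apply: (@leq_trans #|(nbrs E v :&: X) :|: (nbrs E v :&: Y) :|: S|).
    apply/subset_leq_card/subsetP => w wv.
    have := in_setT w; rewrite -XYJS !in_setU !in_setI wv.
    have -> : w \in J = false.
      by apply/negP => wJ; move: wv; rewrite inE; apply/negP/indJ.
    by rewrite orbF.
  by apply: leq_trans (leq_card_setU _ _) _; rewrite leq_add2r leq_card_setU.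
rewrite /major /prefers_X; case: ltnP; move: Sk kd; lia.
Qed.

Lemma bpr_unlinked (q1 q2 z : R) : 0 <= q1 <= 1 -> 0 <= q2 <= 1 -> q2 <= z ->
  (forall t m, (t <= d)%N -> (d <= 4 * m)%N ->
     q2 ^+ t + (1 - q2 ^+ t) * q1 ^+ m <= z ^+ t) ->
  bexp E q1 (fun H1 => bpr E q2 (unlinked H1)) <= z ^+ link_edges.
Proof.
move=> q1_prob q2_prob q2z vertex_le.
have [/andP[q1_ge0 _] /andP[q2_ge0 q2_le1]] := (q1_prob, q2_prob).
have vertex_ge0 t m : 0 <= q2 ^+ t + (1 - q2 ^+ t) * q1 ^+ m.
  by rewrite addr_ge0 ?mulr_ge0 ?exprn_ge0 // subr_ge0 exprn_ile1.
apply: le_trans (bpr_two_rounds (J := J) crossing_sub _ _ minor_disjoint major_disjoint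
  crossing_minor_disjoint q1_prob q2_prob) _; [by move=> v _; apply: edges_to_sub..|].
rewrite /link_edges exprD -prodrXr ler_pM ?exprn_ge0 ?prodr_ge0 //.
  by rewrite lerXn2r // nnegrE ?(le_trans q2_ge0).
by apply: ler_prod => v vJ; rewrite vertex_ge0 vertex_le ?card_minor_le ?card_major_ge.
Qed.

End Cut.

(** * Components after deleting few vertices *)

Section Components.
Variables (T : finType) (E H : {set {set T}}) (S : {set T}) (k : nat).
Hypotheses (sE : simple_graph E) (HE : H \subset E) (Sk : (#|S| < k)%N).
Implicit Types (x y u v w : T) (K H : {set {set T}}) (U V X : {set T}).

Let sH : simple_graph H := simple_graphS HE sE.

Definition stranded : {set T} :=
  [set v | (v \notin S) && [forall w, ~~ adj_avoiding H S v w]].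

Definition component x : {set T} := [set y | connect (adj_avoiding H S) x y].

Definition component_root x : T := fingraph.root (adj_avoiding H S) x.

Definition union_of_components (roots : {set T}) : {set T} :=
  [set x | [&& x \notin S, x \notin stranded & component_root x \in roots]].

Lemma mem_component x y : (y \in component x) = (component_root y == component_root x).
Proof.
rewrite inE adj_avoiding_connect_sym /component_root.
by rewrite fingraph.root_connect //; apply: adj_avoiding_connect_sym.
Qed.

Lemma component_notin x y : x \notin S -> y \in component x -> y \notin S.
Proof. by rewrite inE; apply: connect_avoiding_notin. Qed.

Lemma component_connected x : x \notin S -> connected_in H (component x).
Proof.
move=> xS; apply/forall_inP => u ux; apply/forall_inP => v vx.
pose C := component x; pose reached := [set w in C | connect (adj_avoiding H (~: C)) u w].
suff : v \in reached by rewrite inE => /andP[].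
apply: (@connect_avoiding_in _ H S reached u v); first by rewrite inE ux connect0.
  by move: ux vx; rewrite !inE adj_avoiding_connect_sym => /connect_trans; apply.
move=> a b /[!inE]/andP[xa ua] bS ab; have aS := connect_avoiding_notin xS xa.
have xb : connect (adj_avoiding H S) x b.
  by apply: connect_trans xa (connect1 _); apply/and3P.
rewrite xb; apply: connect_trans ua (connect1 _); apply/and3P.
by rewrite !inE !negbK.
Qed.

Lemma edge_boundary_component x : x \notin S ->
  (edge_boundary H (component x) <= #|S| * #|component x|)%N.
Proof.
move=> xS; pose pairs := setX S (component x).
apply: (@leq_trans #|[set [set p.1; p.2] | p in pairs]|); last first.
  by apply: leq_trans (leq_imset_card _ _) _; rewrite cardsX.
apply: subset_leq_card; apply/subsetP => e eC.
have [u [v [eq_e uC vC]]] := boundary_ends sH eC.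
have eH : e \in H by apply: subsetP eC; apply: boundary_sub.
apply/imsetP; exists (v, u); rewrite ?in_setX ?uC ?andbT 1?setUC //=.
apply: contraR vC => vS; have uS := component_notin xS uC.
move: uC; rewrite !inE => /connect_trans; apply; apply: connect1; apply/and3P.
by rewrite -eq_e.
Qed.

Lemma card_component_gt1 x : x \notin S -> x \notin stranded -> (1 < #|component x|)%N.
Proof.
move=> xS; rewrite inE xS /= negb_forall => /existsP[w]; rewrite negbK => xw.
have x_neq_w : x != w by case/and3P: xw => _ _; apply: simple_edge_neq.
have <- : #|[set x; w]| = 2%N by rewrite cards2 x_neq_w.
by apply: subset_leq_card; rewrite subUset !sub1set !inE connect0 connect1.
Qed.

Lemma stranded_low_degree v : v \in stranded -> (degree H v < k)%N.
Proof.
rewrite inE => /andP[vS /forallP isolated]; rewrite -card_nbrs //.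
apply: leq_ltn_trans Sk; apply: subset_leq_card; apply/subsetP => w; rewrite inE => vw.
by apply: contraR (isolated w) => wS; apply/and3P.
Qed.

Lemma stranded_disjoint : [disjoint stranded & S].
Proof. by rewrite disjoints_subset; apply/subsetP => v; rewrite !inE => /andP[]. Qed.

Lemma union_of_components_disjoint roots :
  [disjoint union_of_components roots & stranded].
Proof.
by rewrite disjoints_subset; apply/subsetP => v; rewrite inE => /and3P[_ vI _]; rewrite inE.
Qed.

Lemma component_sub_unstranded U V x : separation H S U V ->
  x \in U :\: stranded -> component x \subset U :\: stranded.
Proof.
move=> sep /setDP[xU xI]; apply/subsetP => y; rewrite [y \in component _]inE => xy.
have yU : y \in U.
  by apply: connect_avoiding_in xU xy _ => u v; apply: separation_closed sep.
rewrite inE yU andbT; apply: contra xI => yI.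
suff /set1P-> : x \in [set y] by [].
move: yI; rewrite [y \in _]inE => /andP[yS /forallP isolated].
rewrite adj_avoiding_connect_sym in xy.
apply: connect_avoiding_in (set11 y) xy _ => u v /set1P-> vS yv.
by case/negP: (isolated v); apply/and3P.
Qed.

Lemma union_of_components_roots U V : separation H S U V ->
  union_of_components (component_root @: (U :\: stranded)) = U :\: stranded.
Proof.
move=> sep; apply/setP => x; rewrite inE; apply/and3P/idP => [[xS xI /imsetP[y yX]]|xX].
  by move=> /eqP; rewrite -mem_component; apply/subsetP/(component_sub_unstranded sep yX).
split; last exact: imset_f.
  by apply: (separation_notin sep); move: xX; rewrite inE => /andP[].
by move: xX; rewrite inE => /andP[].
Qed.

Variables (R : realFieldType) (L : R).
Hypothesis no_trap : ~~ has_small_trap k L H.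

Lemma card_component_ge x : x \notin S -> x \notin stranded -> L <= #|component x|%:R.
Proof.
move=> xS xI; rewrite leNgt; apply: contra no_trap => /ltW small.
apply/existsP; exists (component x).
rewrite /small_trap card_component_gt1 // small component_connected //=.
by apply: leq_trans (edge_boundary_component xS) _; rewrite leq_mul2r ltnW ?orbT.
Qed.

Lemma card_component_roots U V : separation H S U V ->
  L * #|component_root @: (U :\: stranded)|%:R <= #|U :\: stranded|%:R.
Proof.
move=> sep; rewrite -[in leRHS]sum1_card.
rewrite (partition_big component_root
  (mem (component_root @: (U :\: stranded)))) /=; last first.
  by move=> x; apply: imset_f.
rewrite natr_sum mulr_natr -sumr_const; apply: ler_sum => r /imsetP[x xX ->].
have [xU xI] := setDP xX.
apply: le_trans (card_component_ge (separation_notin sep xU) xI) _.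
rewrite ler_nat sum1dep_card; apply: subset_leq_card; apply/subsetP => y yx.
rewrite inE (subsetP (component_sub_unstranded sep xX) y yx).
by rewrite -mem_component.
Qed.

Definition bad_cut (roots : {set T}) H1 H2 : bool :=
  let X := union_of_components roots in let Y := ~: (X :|: stranded :|: S) in
  [&& L * #|roots|%:R <= #|X|%:R, (#|X| <= #|Y|)%N & unlinked E X Y stranded H1 H2].

Hypothesis no_low_pair : ~~ adjacent_low_degrees E k H.

Lemma stranded_independent : {in stranded &, forall u v, [set u; v] \notin E}.
Proof.
move=> u v uI vI; apply: contra no_low_pair => uvE.
apply/exists_inP; exists [set u; v] => //.
by apply/forall_inP => w; rewrite !inE => /orP[]/eqP->; apply: stranded_low_degree.
Qed.

Lemma separation_unstranded K U V : K \subset E -> min_degree_ge k K ->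
  separation K S U V -> U :\: stranded != set0.
Proof.
move=> KE /forallP degK sep; have [_ _ /set0Pn[u uU] _ _] := sep.
apply/eqP => UI; have stranded_U v : v \in U -> v \in stranded.
  by apply: contraLR => vI; apply/negP => vU; have := in_set0 v; rewrite -UI inE vI vU.
have /subsetPn[w] : ~~ (nbrs K u \subset S).
  apply: contraL (degK u) => /subset_leq_card nbrsS.
  by rewrite -ltnNge -card_nbrs ?(leq_ltn_trans nbrsS) //; apply: simple_graphS sE.
rewrite inE => uw wS; have wU := separation_closed sep uU wS uw.
by have := stranded_independent (stranded_U u uU) (stranded_U w wU); rewrite (subsetP KE).
Qed.

Lemma separation_bad_cut K H1 H2 U V :
  H \subset K -> H1 \subset K -> H2 \subset K -> K \subset E -> min_degree_ge k K ->
  separation K S U V -> (#|U :\: stranded| <= #|V :\: stranded|)%N ->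
  exists2 roots, roots != set0 & bad_cut roots H1 H2.
Proof.
move=> HK H1K H2K KE degK sep leUV; have sepH := separationS HK sep.
exists (component_root @: (U :\: stranded)).
  have /set0Pn[x xX] := separation_unstranded KE degK sep.
  by apply/set0Pn; exists (component_root x); apply: imset_f.
rewrite /bad_cut (union_of_components_roots sepH) (card_component_roots sepH).
have -> : ~: (U :\: stranded :|: stranded :|: S) = V :\: stranded.
  have [UV disUV _ _ _] := sep; apply/setP => y; rewrite in_setC !in_setU !in_setD.
  have := in_setC y S; rewrite -UV in_setU; case: (boolP (y \in V)) => [yV|_].
    by rewrite (disjointFl disUV yV) !orFb => /esym/negbTE->; rewrite andbF orbF andbT.
  by rewrite orbF andbF => /esym; case: (y \in S) (y \in U) (y \in stranded) => [] [] [].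
rewrite leUV; apply: separation_unlinked sep sE H1K H2K _ _ stranded_disjoint;
  exact: subsetDl.
Qed.

End Components.

(** * Reduction to four rare events *)

Section HittingTimes.
Variables (R : realFieldType) (T : finType) (E : {set {set T}}) (k : nat) (L : R).
Hypotheses (sE : simple_graph E) (k_gt0 : (0 < k)%N) (kT : (k < #|T|)%N).
Implicit Types (H K : {set {set T}}).

Definition same_hitting_time : pred (#|E|.-tuple {set T}) := fun s =>
  hitting_time (min_degree_ge k) s == hitting_time (k_connected k) s.

Definition some_bad_cut H H1 H2 : bool := [exists (S : {set T} | (#|S| < k)%N),
  [exists (roots : {set T} | roots != set0), bad_cut E H S L roots H1 H2]].

Lemma not_k_connected_bad_cut H H1 H2 K :
  H \subset K -> H1 \subset K -> H2 \subset K -> K \subset E ->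
  min_degree_ge k K -> ~~ k_connected k K ->
  ~~ has_small_trap k L H -> ~~ adjacent_low_degrees E k H -> some_bad_cut H H1 H2.
Proof.
move=> HK H1K H2K KE degK nconnK no_trap no_low.
have HE := subset_trans HK KE.
have [S [U [V [Sk sep]]]] := not_k_connected_separation kT nconnK.
apply/exists_inP; exists S => //; apply/exists_inP.
have bad := separation_bad_cut sE HE Sk no_trap no_low HK H1K H2K KE degK.
have [|/ltnW] := leqP #|U :\: stranded H S| #|V :\: stranded H S|; first exact: bad sep.
exact: bad (separation_sym sep).
Qed.

Lemma not_forces_hitting H0 H1 H2 :
  let G := H0 :|: (H1 :|: H2) in
  ~~ forces_hitting E (min_degree_ge k) (k_connected k) G ->
  [|| min_degree_ge 1 G, has_small_trap k L H0, adjacent_low_degrees E k H0 |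
      ~~ adjacent_low_degrees E k H0 && some_bad_cut H0 H1 H2].
Proof.
move=> G /nandP[/negPn degG|/forallPn[K K_bad]].
  by apply/orP; left; apply/forallP => v; apply: leq_trans k_gt0 (forallP degG v).
rewrite !negb_imply !subUset in K_bad.
have /andP[/andP[/and3P[H0K H1K H2K] KE] /andP[degK nconnK]] := K_bad.
have [|no_trap] := boolP (has_small_trap k L H0); first by rewrite orbT.
have [|no_low] := boolP (adjacent_low_degrees E k H0); first by rewrite !orbT.
by rewrite (not_k_connected_bad_cut H0K H1K H2K KE degK nconnK no_trap no_low) !orbT.
Qed.

Lemma process_prob_same_hitting_time_union (q0 q1 q2 b : R) :
  0 <= q0 <= 1 -> 0 <= q1 <= 1 -> 0 <= q2 <= 1 -> 0 <= b ->
  (forall H, H \subset E -> ~~ adjacent_low_degrees E k H ->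
     bexp E q1 (fun H1 => bpr E q2 (some_bad_cut H H1)) <= b) ->
  1 - process_prob R same_hitting_time <=
  bpr E (q0 * (q1 * q2)) (min_degree_ge 1) + bpr E q0 (has_small_trap k L)
  + bpr E q0 (adjacent_low_degrees E k) + b.
Proof.
move=> q0_prob q1_prob q2_prob b_ge0 bad_cut_le.
have q_prob : 0 <= q0 * (q1 * q2) <= 1.
  move: q0_prob q1_prob q2_prob => /andP[? ?] /andP[? ?] /andP[? ?].
  by rewrite !mulr_ge0 // !mulr_ile1 ?mulr_ge0.
pose forcing := forces_hitting E (min_degree_ge k) (k_connected k).
apply: le_trans (process_probC_le_bpr (good := forcing) q_prob _) _.
  move=> s m os forced; apply/eqP; apply: hitting_time_eq os forced.
    by move=> G K; apply: min_degree_geS.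
  by move=> K KE; apply/k_connected_min_degree/(simple_graphS KE).
rewrite /bpr -!bexp_setU.
under [X in _ <= X + _ + _ + _]eq_bexp do rewrite -bexp_setU.
under [X in X <= _]eq_bexp do rewrite -bexp_setU.
rewrite -!bexpD -[b in leRHS](bexp_cst E q0) -bexpD.
apply: ler_bexp => // H0 H0E.
apply: (@le_trans _ _ (bexp E q1 (fun H1 => bexp E q2 (fun H2 =>
    (min_degree_ge 1 (H0 :|: (H1 :|: H2)))%:R + (has_small_trap k L H0)%:R
    + (adjacent_low_degrees E k H0)%:R
    + (~~ adjacent_low_degrees E k H0)%:R * (some_bad_cut H0 H1 H2)%:R)))).
  apply: ler_bexp => // H1 _; apply: ler_bexp => // H2 _.
  rewrite -natrM mulnb -!natrD ler_nat /=.
  have /= := @not_forces_hitting H0 H1 H2.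
  rewrite -/forcing; case: (forcing _) => //= /(_ isT).
  by case: min_degree_ge; case: has_small_trap; case: adjacent_low_degrees;
    case: some_bad_cut.
under eq_bexp => H1 _ do rewrite !bexpD !bexp_cst bexpZ.
rewrite !bexpD !bexp_cst bexpZ lerD2l.
have [_|no_low] := boolP (adjacent_low_degrees E k H0); first by rewrite mul0r.
by rewrite mul1r; apply: bad_cut_le.
Qed.

End HittingTimes.

Section BadCuts.
Variables (R : realFieldType) (T : finType) (E : {set {set T}}) (d k : nat).
Hypotheses (sE : simple_graph E) (rE : regular d E) (kd : (2 * k <= d)%N).
Variables (q1 q2 z w c L : R).
Hypotheses (q1_prob : 0 <= q1 <= 1) (q2_prob : 0 <= q2 <= 1) (q2_le_z : q2 <= z)
  (w_ge0 : 0 <= w) (c_ge0 : 0 <= c).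
Hypothesis vertex_le : forall t m, (t <= d)%N -> (d <= 4 * m)%N ->
  q2 ^+ t + (1 - q2 ^+ t) * q1 ^+ m <= z ^+ t.
Hypothesis links_le : forall t r, (0 < r)%N ->
  c * (L * r%:R) <= (t + k * d)%:R -> z ^+ t <= w ^+ r.
Hypothesis expansion : edge_expanding E (#|T|%:R / 2) c.
Variable H : {set {set T}}.
Hypotheses (HE : H \subset E) (no_low_pair : ~~ adjacent_low_degrees E k H).

Lemma bpr_bad_cut (S roots : {set T}) : (#|S| < k)%N -> roots != set0 ->
  bexp E q1 (fun H1 => bpr E q2 (bad_cut E H S L roots H1)) <= w ^+ #|roots|.
Proof.
move=> Sk roots_neq0; rewrite /bad_cut.
set X := union_of_components H S roots; set J := stranded H S; set Y := ~: _.
have [/andP[card_X XY]|not_large] :=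
    boolP ((L * #|roots|%:R <= #|X|%:R) && (#|X| <= #|Y|)%N); last first.
  apply: (@le_trans _ _ 0); last by rewrite exprn_ge0.
  rewrite -(bexp_cst E q1 0) -(bexp_cst E q2 0).
  apply: ler_bexp => // H1 _; apply: ler_bexp => // H2 _.
  by rewrite andbA (negbTE not_large).
apply: (@le_trans _ _ (bexp E q1 (fun H1 => bpr E q2 (unlinked E X Y J H1)))).
  by apply: ler_bexp => // H1 _; apply: ler_bpr => // H2 _ /and3P[].
have disXJ : [disjoint X & J] := union_of_components_disjoint H S roots.
have notY v : v \in X :|: J :|: S -> v \notin Y by rewrite in_setC negbK.
have disXY : [disjoint X & Y].
  by rewrite disjoints_subset; apply/subsetP => v vX; rewrite inE notY // !in_setU vX.
have disYJ : [disjoint Y & J].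
  rewrite disjoint_sym disjoints_subset; apply/subsetP => v vJ.
  by rewrite inE notY // !in_setU vJ orbT.
have XYJS : X :|: Y :|: J :|: S = [set: T].
  by apply/setP => v; rewrite !in_setU in_setC !in_setU in_setT; do !case: (v \in _).
have indJ := stranded_independent sE HE Sk no_low_pair.
apply: le_trans (bpr_unlinked sE rE disXY disXJ disYJ XYJS Sk indJ kd
  q1_prob q2_prob q2_le_z vertex_le) _.
apply: links_le; first by rewrite card_gt0.
apply: le_trans (link_edges_ge sE rE disXY disXJ disYJ XYJS Sk indJ c_ge0 XY expansion).
by rewrite ler_wpM2l.
Qed.

Lemma bpr_some_bad_cut :
  bexp E q1 (fun H1 => bpr E q2 (some_bad_cut E k L H H1))
  <= #|[set S : {set T} | (#|S| < k)%N]|%:R * ((1 + w) ^+ #|T| - 1).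
Proof.
have <- : \sum_(roots : {set T} | roots != set0) w ^+ #|roots| = (1 + w) ^+ #|T| - 1.
  by rewrite -sum_expr_card [in RHS](bigD1 set0) //= cards0 expr0 addrAC subrr add0r.
apply: le_trans (bexp_bpr_exists _ _ _ q1_prob q2_prob) _.
rewrite cardsE mulr_natl -sumr_const; apply: ler_sum => S Sk.
apply: le_trans (bexp_bpr_exists _ _ _ q1_prob q2_prob) _.
by apply: ler_sum => roots; apply: bpr_bad_cut.
Qed.

End BadCuts.

(** * Estimates *)

Section RealBounds.
Variable R : realType.
Implicit Types u x y : R.

Lemma expRN_unit u : 0 <= u -> 0 < expR (- u) <= 1.
Proof. by move=> u_ge0; rewrite expR_gt0 expR_le1 oppr_le0. Qed.

Lemma expRN1_le : expR (- 1) <= 1 / 2 :> R.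
Proof.
by rewrite expRN div1r lef_pV2 ?posrE ?expR_gt0 //; have := expR_ge1Dx (1 : R).
Qed.

Lemma expRN_le u : 0 <= u <= 1 -> expR (- u) <= 1 - u / 2.
Proof.
case/andP=> u_ge0 u_le1; have u1_gt0 : 0 < 1 + u by lra.
rewrite expRN; apply: (@le_trans _ _ (1 + u)^-1).
  by rewrite lef_pV2 ?posrE ?expR_gt0 // expR_ge1Dx.
by rewrite -div1r ler_pdivrMr //; nra.
Qed.

Lemma expR_le_linear u : 0 <= u <= 1 / 2 -> expR u <= 1 + 2 * u.
Proof.
case/andP=> u_ge0 u_le; have u1_gt0 : 0 < 1 - u by lra.
rewrite -[expR u]invrK -expRN; apply: (@le_trans _ _ (1 - u)^-1).
  by rewrite lef_pV2 ?posrE ?expR_gt0 // expR_ge1Dx.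
by rewrite -div1r ler_pdivrMr //; nra.
Qed.

Lemma near_polynomial_le_expR (K delta : R) (j : nat) : 0 < delta ->
  \forall y \near +oo%R, K * y ^+ j <= expR (delta * y).
Proof.
move=> delta_gt0; pose A := delta ^+ j.+1 / (j.+1`!)%:R.
have A_gt0 : 0 < A by rewrite divr_gt0 ?exprn_gt0 // ltr0n fact_gt0.
near=> y; have y_ge0 : 0 <= y by near: y; apply: nbhs_pinfty_ge.
have y_ge : K / A <= y by near: y; apply: nbhs_pinfty_ge; apply: num_real.
apply: le_trans (expR_ge1Dxn j (mulr_ge0 (ltW delta_gt0) y_ge0)).
apply: (@le_trans _ _ (A * y ^+ j.+1)); last by rewrite exprMn mulrAC lerDr.
by rewrite exprS mulrA ler_wpM2r ?exprn_ge0 // mulrC -ler_pdivrMr.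
Unshelve. all: by end_near. Qed.

Lemma sum_exprn_ge2_le (r : R) (N : nat) : 0 <= r <= 1 / 2 ->
  \sum_(m < N | (1 < m)%N) r ^+ m <= 2 * r ^+ 2.
Proof.
case/andP=> r_ge0 r_le.
have geometric_le M : \sum_(m < M) r ^+ m <= 2.
  have : (1 - r) * \sum_(m < M) r ^+ m <= 1.
    by rewrite -opprB mulNr -subrX1 opprB gerBl exprn_ge0.
  have : 0 <= \sum_(m < M) r ^+ m by apply: sumr_ge0 => m _; rewrite exprn_ge0.
  by set s := \sum_(m < M) _; nra.
rewrite big_mkcond; case: N => [|[|N]].
- by rewrite big_ord0 mulr_ge0 ?exprn_ge0.
- by rewrite big_ord1 mulr_ge0 ?exprn_ge0.
rewrite !big_ord_recl /= !add0r.
rewrite (eq_bigr (fun m : 'I_N => r ^+ 2 * r ^+ m)) => [|m _]; last by rewrite -exprD.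
by rewrite -mulr_sumr mulrC ler_wpM2r ?geometric_le ?exprn_ge0.
Qed.

Lemma card_small_sets_le (T : finType) (k : nat) : (0 < #|T|)%N ->
  #|[set S : {set T} | (#|S| < k)%N]|%:R <= expR 1 * #|T|%:R ^+ k :> R.
Proof.
move=> T_gt0; set n : R := #|T|%:R; have n_gt0 : 0 < n by rewrite ltr0n.
have n_ge1 : 1 <= n by rewrite ler1n.
apply: (@le_trans _ _ (\sum_(S : {set T}) n ^+ k * n^-1 ^+ #|S|)); last first.
  rewrite -mulr_sumr sum_expr_card mulrC ler_wpM2r ?exprn_ge0 ?(ltW n_gt0) //.
  have -> : expR 1 = expR n^-1 ^+ #|T| :> R by rewrite -expRM_natl divff ?gt_eqF.
  by rewrite lerXn2r ?nnegrE ?expR_ge0 ?expR_ge1Dx // addr_ge0 // invr_ge0 ltW.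
rewrite -sum1_card natr_sum big_mkcond /=; apply: ler_sum => S _.
case: ifP => [|_]; last by rewrite mulr_ge0 // exprn_ge0 ?invr_ge0 // ltW.
rewrite inE => /ltnW Sk.
by rewrite exprVn ler_pdivlMr ?exprn_gt0 // mul1r ler_weXn2l.
Qed.

End RealBounds.

Section Estimates.
Variables (R : realType) (d k : nat) (b y : R).

(* With y = ln n, a vertex is isolated in the base round with probability
   base_miss ^+ d = n^(-(1 - b/4)). *)
Definition miss_rate : R := (1 - b / 4) * y / d%:R.

Definition base_miss : R := expR (- miss_rate).

(* A vertex of J has at least d/4 major edges, so H1 contains none of them with
   probability at most 1/e. *)
Definition major_miss : R := expR (- (4 / d%:R)).

Definition minor_miss : R := expR (- d%:R^-1).

(* This value makes (1 - base_miss) * tilt at most base_miss / d. *)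
Definition tilt : R := base_miss / y.

Definition boundary_decay : R := expR (1 - (1 - b / 4) * (19 / 20) * y).

Definition link_decay : R := expR (- (d%:R^-1 / 4)).

Definition root_decay : R := expR (- ((k%:R + 2) * y)).

Hypotheses (d_gt0 : (0 < d)%N) (y_ge1 : 1 <= y) (b_gt0 : 0 < b) (b_le : b <= 1 / 2)
  (d_large : 200 * (k%:R + 1) <= b * d%:R).

Let dR_gt0 : 0 < d%:R :> R. Proof. by rewrite ltr0n. Qed.

Let dV_ge0 : 0 <= d%:R^-1 :> R. Proof. by rewrite invr_ge0. Qed.

Let mul_dV : d%:R / d%:R = 1 :> R. Proof. by rewrite divff ?gt_eqF. Qed.

Let y_gt0 : 0 < y. Proof. exact: lt_le_trans y_ge1. Qed.

Lemma miss_rate_ge0 : 0 <= miss_rate.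
Proof. by rewrite !mulr_ge0 ?(ltW y_gt0) //; move: b_le b_gt0; lra. Qed.

Lemma d_miss_rate : d%:R * miss_rate = (1 - b / 4) * y.
Proof. by rewrite /miss_rate mulrC divfK ?gt_eqF. Qed.

Lemma d_miss_rate_le : d%:R * miss_rate <= y.
Proof. by rewrite d_miss_rate ler_piMl ?(ltW y_gt0) //; move: b_gt0; lra. Qed.

Lemma miss_rate_small : (k%:R + 1) * miss_rate <= b / 200 * y.
Proof.
rewrite -(ler_pM2r dR_gt0).
have -> : (k%:R + 1) * miss_rate * d%:R = (k%:R + 1) * (d%:R * miss_rate) by ring.
apply: (@le_trans _ _ ((k%:R + 1) * y)); first by rewrite ler_wpM2l ?d_miss_rate_le.
by rewrite mulrAC ler_wpM2r ?(ltW y_gt0) //; move: d_large; lra.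
Qed.

Lemma miss_rate_bounds : [/\ 0 <= miss_rate, 0 <= k%:R * miss_rate,
  k%:R * miss_rate + miss_rate <= b / 200 * y & 0 < b * y].
Proof.
have s_ge0 := miss_rate_ge0; split; [by []|exact: mulr_ge0| |exact: mulr_gt0].
by have := miss_rate_small; rewrite mulrDl mul1r.
Qed.

Lemma base_miss_unit : 0 < base_miss <= 1.
Proof. exact/expRN_unit/miss_rate_ge0. Qed.

Lemma tilt_unit : 0 < tilt <= 1.
Proof.
have /andP[q_gt0 q_le1] := base_miss_unit.
by rewrite divr_gt0 //= ler_pdivrMr // mul1r (le_trans q_le1).
Qed.

Lemma tiltVX m : tilt^-1 ^+ m = y ^+ m * expR (m%:R * miss_rate).
Proof. by rewrite invf_div -expRN opprK exprMn expRM_natl. Qed.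

Lemma subr_base_miss_le : 1 - base_miss <= miss_rate.
Proof. by have := expR_ge1Dx (- miss_rate); rewrite /base_miss; lra. Qed.

Definition mixture : R := base_miss + (1 - base_miss) * tilt.

Lemma mixture_ge0 : 0 <= mixture.
Proof.
have [/andP[q_gt0 q_le1] /andP[x_gt0 _]] := (base_miss_unit, tilt_unit).
by rewrite addr_ge0 ?(ltW q_gt0) // mulr_ge0 ?subr_ge0 // ltW.
Qed.

Lemma mixture_le : mixture <= expR (d%:R^-1 - miss_rate).
Proof.
have /andP[q_gt0 _] := base_miss_unit.
have -> : mixture = base_miss * (1 + (1 - base_miss) / y) by rewrite /mixture /tilt; ring.
rewrite [_ - miss_rate]addrC expRD ler_wpM2l ?(ltW q_gt0) //.
apply: le_trans (expR_ge1Dx _); rewrite lerD2l ler_pdivrMr // mulrC.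
by rewrite ler_pdivlMr // mulrC (le_trans _ d_miss_rate_le) // ler_wpM2l ?subr_base_miss_le.
Qed.

Lemma mixture_expr_le (m B : nat) :
  (B <= m * d)%N -> 19 / 20 * d%:R * m%:R <= B%:R :> R ->
  mixture ^+ B <= boundary_decay ^+ m.
Proof.
move=> B_le B_ge; apply: (@le_trans _ _ (expR (d%:R^-1 - miss_rate) ^+ B)).
  by rewrite lerXn2r ?nnegrE ?expR_ge0 ?mixture_ge0 ?mixture_le.
rewrite -!expRM_natl ler_expR mulrBr.
have Bd_le : B%:R / d%:R <= m%:R :> R by rewrite ler_pdivrMr // -natrM ler_nat.
have : 19 / 20 * ((1 - b / 4) * y) * m%:R <= B%:R * miss_rate.
  rewrite -d_miss_rate; apply: le_trans (ler_wpM2r miss_rate_ge0 B_ge).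
  by rewrite le_eqVlt; apply/predU1P; left; ring.
by move: Bd_le; lra.
Qed.

Lemma trap_ratio_le : 4 * expR 1 * y ^+ k.+1 <= expR (1 / 100 * y) ->
  4 * y * (boundary_decay * tilt^-1 ^+ k) <= expR (- (3 / 4 * y)).
Proof.
move=> y_large; have -> : 4 * y * (boundary_decay * tilt^-1 ^+ k) =
    4 * expR 1 * y ^+ k.+1 * expR (k%:R * miss_rate - (1 - b / 4) * (19 / 20) * y).
  by rewrite /boundary_decay tiltVX !expRD exprS; ring.
apply: le_trans (ler_wpM2r (expR_ge0 _) y_large) _.
rewrite -expRD ler_expR; have [? ? ? ?] := miss_rate_bounds.
have : b * y <= 1 / 2 * y by rewrite ler_wpM2r ?(ltW y_gt0).
by lra.
Qed.

Lemma trap_term_le (x : R) m : 0 <= x ->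
  (2 ^ (2 * m).-1 * d ^ m.-1)%:R * ((1 - base_miss) ^+ m.-1 * x ^+ m) <= (4 * y * x) ^+ m.
Proof.
move=> x_ge0; have /andP[_ q_le1] := base_miss_unit.
rewrite mulrA [leRHS]exprMn ler_wpM2r ?exprn_ge0 // natrM !natrX.
rewrite -mulrA -[_ * _ ^+ _]exprMn [leRHS]exprMn.
apply: ler_pM; rewrite ?exprn_ge0 ?mulr_ge0 ?subr_ge0 //.
  by rewrite -[4]/(2 * 2)%:R natrM -expr2 -exprM ler_weXn2l ?ler1n // leq_pred.
apply: (@le_trans _ _ (y ^+ m.-1)); last by rewrite ler_weXn2l // leq_pred.
rewrite lerXn2r ?nnegrE ?mulr_ge0 ?subr_ge0 ?(ltW y_gt0) //.
by apply: le_trans d_miss_rate_le; rewrite ler_wpM2l ?subr_base_miss_le.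
Qed.

Lemma small_trap_bound_le (n : nat) : n%:R = expR y :> R -> 2 <= y ->
  4 * expR 1 * y ^+ k.+1 <= expR (1 / 100 * y) ->
  \sum_(m < n.+1 | (1 < m)%N) n%:R * (2 ^ (2 * m).-1 * d ^ m.-1)%:R *
    ((1 - base_miss) ^+ m.-1 * (boundary_decay * tilt^-1 ^+ k) ^+ m)
  <= 2 * expR (- (1 / 2 * y)).
Proof.
move=> ny y_ge2 y_large; have /andP[x_gt0 _] := tilt_unit.
set x := boundary_decay * _; pose r := 4 * y * x.
have x_ge0 : 0 <= x by rewrite mulr_ge0 ?expR_ge0 // exprn_ge0 // invr_ge0 ltW.
have r_ge0 : 0 <= r by rewrite mulr_ge0 // mulr_ge0 // ltW.
have r_le : r <= expR (- (3 / 4 * y)) := trap_ratio_le y_large.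
have r_le_half : r <= 1 / 2.
  by apply: le_trans (le_trans r_le _) (expRN1_le R); rewrite ler_expR; lra.
apply: (@le_trans _ _ (\sum_(m < n.+1 | (1 < m)%N) n%:R * r ^+ m)).
  by apply: ler_sum => m _; rewrite -mulrA ler_wpM2l // trap_term_le.
rewrite -mulr_sumr; apply: (@le_trans _ _ (n%:R * (2 * r ^+ 2))).
  by rewrite ler_wpM2l // sum_exprn_ge2_le ?r_ge0.
apply: (@le_trans _ _ (expR y * (2 * expR (- (3 / 4 * y)) ^+ 2))).
  by rewrite ny !ler_wpM2l ?expR_ge0 // lerXn2r ?nnegrE ?expR_ge0.
by rewrite -expRM_natl mulrCA -expRD ler_wpM2l // ler_expR; move: y_gt0; lra.
Qed.

Lemma mixture_edge_le :
  mixture ^+ (2 * d.-1) <= expR (2 + 2 * miss_rate - 2 * ((1 - b / 4) * y)).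
Proof.
apply: (@le_trans _ _ (expR (d%:R^-1 - miss_rate) ^+ (2 * d.-1))).
  by rewrite lerXn2r ?nnegrE ?expR_ge0 ?mixture_ge0 ?mixture_le.
rewrite -expRM_natl ler_expR -d_miss_rate -subn1 natrM natrB //.
have -> : 2 * (d%:R - 1) * (d%:R^-1 - miss_rate) =
  2 * (d%:R / d%:R) - 2 * d%:R^-1 + 2 * miss_rate - 2 * (d%:R * miss_rate) by ring.
by rewrite mul_dV; move: dV_ge0; lra.
Qed.

Lemma low_degrees_bound_le (n M : nat) : n%:R = expR y :> R -> (M <= n * d)%N ->
  d%:R <= expR ((1 - b) * y) -> expR 2 * y ^+ (2 * k) <= expR (b / 8 * y) ->
  M%:R * (mixture ^+ (2 * d.-1) * tilt^-1 ^+ (2 * k)) <= expR (- (b / 4 * y)).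
Proof.
move=> ny M_le d_le y_large.
have M_le_exp : M%:R <= expR (y + (1 - b) * y).
  apply: (@le_trans _ _ (n * d)%:R); first by rewrite ler_nat.
  by rewrite natrM ny expRD ler_wpM2l ?expR_ge0.
have tilt_le : tilt^-1 ^+ (2 * k) <= expR (b / 8 * y - 2 + 2 * (k%:R * miss_rate)).
  rewrite tiltVX natrM -mulrA expRD ler_wpM2r ?expR_ge0 //.
  by rewrite expRD expRN ler_pdivlMr ?expR_gt0 // mulrC.
have x_ge0 : 0 <= tilt^-1 ^+ (2 * k).
  by rewrite exprn_ge0 // invr_ge0 ltW //; case/andP: tilt_unit.
apply: le_trans (ler_pM _ _ M_le_exp (ler_pM _ x_ge0 mixture_edge_le tilt_le)) _.
- exact: ler0n.
- by rewrite mulr_ge0 // exprn_ge0 ?mixture_ge0.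
- by rewrite exprn_ge0 ?mixture_ge0.
rewrite -!expRD ler_expR; have [? ? ? ?] := miss_rate_bounds.
by move: y_gt0; lra.
Qed.

Lemma isolated_bound_le (n : nat) : n%:R = expR y :> R -> d%:R <= expR ((1 - b) * y) ->
  (n%:R * (base_miss * (major_miss * minor_miss)) ^+ d)^-1
  + d%:R / (n%:R * (base_miss * (major_miss * minor_miss)))
  <= 2 * expR 5 * expR (- (b / 4 * y)).
Proof.
move=> ny d_le; pose rate := miss_rate + 5 / d%:R.
have -> : base_miss * (major_miss * minor_miss) = expR (- rate).
  by rewrite -!expRD /rate; congr expR; ring.
have d_rate : d%:R * rate = (1 - b / 4) * y + 5.
  by rewrite mulrDr d_miss_rate mulrCA mul_dV mulr1.
have dV_le1 : d%:R^-1 <= 1 :> R by rewrite invf_le1 // ler1n.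
have first_le : (n%:R * expR (- rate) ^+ d)^-1 <= expR 5 * expR (- (b / 4 * y)).
  rewrite ny -expRM_natl -expRD -expRN -expRD ler_expR mulrN d_rate.
  by move: y_gt0; lra.
have second_le : d%:R / (n%:R * expR (- rate)) <= expR 5 * expR (- (b / 4 * y)).
  apply: (@le_trans _ _ (expR ((1 - b) * y) / (n%:R * expR (- rate)))).
    by rewrite ler_wpM2r // invr_ge0 mulr_ge0 ?expR_ge0.
  rewrite ny -expRD -expRN -!expRD ler_expR /rate; have [? ? ? ?] := miss_rate_bounds.
  by move: y_gt0 dV_le1; lra.
apply: le_trans (lerD first_le second_le) _.
by rewrite -[2 * _ * _]mulrA mulr_natl mulr2n.
Qed.

Lemma vertex_unlinked_le t m : (t <= d)%N -> (d <= 4 * m)%N ->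
  minor_miss ^+ t + (1 - minor_miss ^+ t) * major_miss ^+ m <= link_decay ^+ t.
Proof.
move=> t_le m_ge; rewrite -!expRM_natl !mulrN; pose u : R := t%:R / d%:R.
have u_bounds : 0 <= u <= 1 by rewrite divr_ge0 //= ler_pdivrMr // mul1r ler_nat.
have major_le : expR (- (m%:R * (4 / d%:R))) <= 1 / 2 :> R.
  apply: le_trans (expRN1_le R); rewrite ler_expR lerN2 mulrA ler_pdivlMr // mul1r.
  by rewrite -natrM mulnC ler_nat.
have minor_le := expRN_le u_bounds.
have minor_le1 : expR (- u) <= 1 by rewrite expR_le1 oppr_le0; case/andP: u_bounds.
apply: (@le_trans _ _ (1 - u / 4)); last first.
  by rewrite mulrA; apply: expR_ge1Dx.
apply: (@le_trans _ _ (expR (- u) + (1 - expR (- u)) * (1 / 2))).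
  by rewrite lerD2l ler_wpM2l // subr_ge0.
by move: minor_le; lra.
Qed.

Lemma links_decay_le (c : R) t r : 0 < c -> (0 < r)%N ->
  c * (8 * (k%:R + 2) / c * d%:R * y * r%:R) <= (t + k * d)%:R ->
  link_decay ^+ t <= root_decay ^+ r.
Proof.
move=> c_gt0 r_gt0; rewrite -!expRM_natl ler_expR !mulrN lerN2.
have -> : c * (8 * (k%:R + 2) / c * d%:R * y * r%:R)
    = 8 * (r%:R * ((k%:R + 2) * y)) * d%:R.
  by field; rewrite gt_eqF.
rewrite -ler_pdivlMr // natrD natrM [(_ + _) / _]mulrDl mulfK ?gt_eqF // => t_ge.
have : (k%:R + 2) * 1 <= (k%:R + 2) * y by rewrite ler_wpM2l // addr_ge0.
have : (k%:R + 2) * y <= r%:R * ((k%:R + 2) * y).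
  by rewrite ler_peMl ?ler1n // mulr_ge0 ?(ltW y_gt0) // addr_ge0.
have : 0 <= k%:R :> R by [].
by rewrite mulrA; move: t_ge; lra.
Qed.

Lemma bad_cut_bound_le (T : finType) : #|T|%:R = expR y :> R ->
  #|[set S : {set T} | (#|S| < k)%N]|%:R * ((1 + root_decay) ^+ #|T| - 1)
  <= 2 * expR 1 * expR (- (1 / 2 * y)).
Proof.
move=> ny; have T_gt0 : (0 < #|T|)%N by rewrite -(ltr0n R) ny expR_gt0.
have n_root_decay : #|T|%:R * root_decay = expR (- ((k%:R + 1) * y)).
  by rewrite ny /root_decay -expRD; congr expR; ring.
have ky_ge1 : 1 <= (k%:R + 1) * y.
  by rewrite -[leLHS]mul1r ler_pM // lerDr.
have n_root_decay_le : 0 <= #|T|%:R * root_decay <= 1 / 2.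
  by rewrite n_root_decay expR_ge0 (le_trans _ (expRN1_le R)) // ler_expR lerN2.
have roots_le : (1 + root_decay) ^+ #|T| - 1 <= 2 * expR (- ((k%:R + 1) * y)).
  rewrite lerBlDl -n_root_decay; apply: le_trans (expR_le_linear n_root_decay_le).
  rewrite expRM_natl lerXn2r ?nnegrE ?addr_ge0 ?expR_ge0 //; exact: expR_ge1Dx.
have roots_ge0 : 0 <= (1 + root_decay) ^+ #|T| - 1.
  by rewrite subr_ge0 exprn_ege1 // lerDl expR_ge0.
have cuts_le := card_small_sets_le R k T_gt0; rewrite ny -expRM_natl in cuts_le.
apply: le_trans (ler_pM (ler0n _ _) roots_ge0 cuts_le roots_le) _.
rewrite mulrCA mulrA mulrA -mulrA -expRD ler_wpM2l ?mulr_ge0 ?expR_ge0 // ler_expR.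
by move: y_gt0; lra.
Qed.

End Estimates.

(** * The limit theorem *)

Section Limits.
Variable R : realType.
Local Open Scope classical_set_scope.

Definition large_enough (k : nat) (b y : R) : Prop := [/\ k%:R + 2 <= y,
  4 * expR 1 * y ^+ k.+1 <= expR (1 / 100 * y) &
  expR 2 * y ^+ (2 * k) <= expR (b / 8 * y)].

Lemma near_large_enough k b : 0 < b -> \forall y \near +oo, large_enough k b y.
Proof.
move=> b_gt0; near=> y; split; near: y.
- by apply: nbhs_pinfty_ge; apply: num_real.
- by apply: near_polynomial_le_expR; lra.
- by apply: near_polynomial_le_expR; rewrite divr_gt0.
Unshelve. all: by end_near. Qed.

Lemma cvg_lny : ln x @[x --> +oo] --> (+oo : set_system R).
Proof.
apply/cvgryPge => A; near=> x.
have x_ge : expR A <= x by near: x; apply: nbhs_pinfty_ge; apply: num_real.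
by rewrite -ler_expR lnK // posrE (lt_le_trans (expR_gt0 A)).
Unshelve. all: by end_near. Qed.

Lemma cvg_ln_natr (n : nat -> nat) :
  n @ \oo --> \oo -> ln (n i)%:R @[i --> \oo] --> (+oo : set_system R).
Proof. by move=> noo; apply: cvg_comp (proj2 (cvgrnyP _) noo) cvg_lny. Qed.

Lemma powR_le_expR_ln (x a b : R) : 1 <= x -> b <= a ->
  x `^ (1 - a) <= expR ((1 - b) * ln x).
Proof.
move=> x_ge1 b_le_a; rewrite /powR gt_eqF ?(lt_le_trans ltr01) //.
by rewrite ler_expR ler_wpM2r ?ln_ge0 // lerD2l lerN2.
Qed.

Lemma cvg1_expRN_le (I : Type) (F : set_system I) {FF : Filter F} (K delta : R)
    (f y : I -> R) :
  0 < delta -> y @ F --> +oo -> (forall i, f i <= 1) ->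
  (\forall i \near F, 1 - f i <= K * expR (- (delta * y i))) -> f @ F --> (1 : R).
Proof.
move=> delta_gt0 yy f_le1 f_ge.
apply: (@squeeze_cvgr _ _ _ _ (fun i => 1 - K * expR (- (delta * y i))) (fun=> 1)).
- by apply: filterS f_ge => i; rewrite f_le1 andbT lerBlDr addrC -lerBlDr.
- rewrite -[X in _ --> X]subr0 -[X in _ - X](mulr0 K).
  apply: cvgB; first exact: cvg_cst; apply: cvgMr.
  apply: (cvg_comp y (fun x => expR (- (delta * x))) yy).
  exact: (cvg_comp _ _ (gt0_cvgMry delta_gt0 cvg_id) (@cvgr_expR R)).
- exact: cvg_cst.
Qed.

End Limits.

Section SameHittingTime.
Variables (R : realType) (T : finType) (E : {set {set T}}).

Lemma process_prob_same_hitting_time0 :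
  (0 < #|T|)%N -> process_prob R (same_hitting_time (E := E) 0) = 1.
Proof.
move=> T_gt0; rewrite -(process_probT R E) /process_prob; apply: eq_bigl => s.
rewrite /same_hitting_time /hitting_time /=.
have -> : min_degree_ge 0 (graph_at s 0) by apply/forallP.
suff -> : k_connected 0 (graph_at s 0) by [].
by rewrite /k_connected T_gt0; apply/forallP => S; rewrite ltn0.
Qed.

Variables (d k : nat) (b c : R).
Let y : R := ln #|T|%:R.

Definition component_size : R := 8 * (k%:R + 2) / c * d%:R * y.

Hypotheses (sE : simple_graph E) (rE : regular d E) (k_gt0 : (0 < k)%N)
  (c_gt0 : 0 < c) (b_gt0 : 0 < b) (b_le : b <= 1 / 2).
Hypotheses (y_large : large_enough k b y) (d_large : 200 * (k%:R + 1) <= b * d%:R)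
  (d_le : d%:R <= expR ((1 - b) * y)).
Hypotheses (expansion : edge_expanding E (#|T|%:R / 2) c)
  (small_expansion : edge_expanding E component_size (19 / 20 * d%:R)).

Let kR_ge0 : 0 <= k%:R :> R. Proof. by []. Qed.

Let y_ge2 : 2 <= y.
Proof. by case: y_large => y_ge _ _; move: kR_ge0; lra. Qed.

Let y_ge1 : 1 <= y.
Proof. by move: y_ge2; lra. Qed.

Let T_gt0 : (0 < #|T|)%N.
Proof. by rewrite lt0n; apply: contraTneq y_ge1 => T0; rewrite /y T0 ln0 // -ltNge. Qed.

Let ny : #|T|%:R = expR y :> R.
Proof. by rewrite lnK // posrE ltr0n. Qed.

Let d_gt0 : (0 < d)%N.
Proof.
rewrite lt0n; apply: contraTneq d_large => ->; rewrite mulr0 -ltNge.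
by move: kR_ge0; lra.
Qed.

Let base_unit : 0 < base_miss d b y <= 1 := base_miss_unit d y_ge1 b_gt0 b_le.

Let x_unit : 0 < tilt d b y <= 1 := tilt_unit d y_ge1 b_gt0 b_le.

Let major_unit : 0 < major_miss R d <= 1.
Proof. by apply: expRN_unit; rewrite divr_ge0. Qed.

Let minor_unit : 0 < minor_miss R d <= 1.
Proof. by apply: expRN_unit; rewrite invr_ge0. Qed.

Let unit_prob (q : R) : 0 < q <= 1 -> 0 <= q <= 1.
Proof. by case/andP=> /ltW-> ->. Qed.

Lemma bpr_min_degree_gt0_le :
  bpr E (base_miss d b y * (major_miss R d * minor_miss R d)) (min_degree_ge 1)
  <= 2 * expR 5 * expR (- (b / 4 * y)).
Proof.
have miss_unit : 0 < base_miss d b y * (major_miss R d * minor_miss R d) <= 1.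
  move: base_unit major_unit minor_unit => /andP[? ?] /andP[? ?] /andP[? ?].
  by rewrite !mulr_gt0 // !mulr_ile1 ?mulr_ge0 // ltW.
apply: le_trans (bpr_min_degree_gt0 sE rE miss_unit d_gt0 T_gt0) _.
exact: (isolated_bound_le d_gt0 y_ge1 b_gt0 b_le d_large ny d_le).
Qed.

Lemma bpr_has_small_trap_le :
  bpr E (base_miss d b y) (has_small_trap k component_size) <= 2 * expR (- (1 / 2 * y)).
Proof.
apply: le_trans (bpr_has_small_trap k sE rE (unit_prob base_unit) x_unit
  (expR_ge0 _ : 0 <= boundary_decay b y) _) _.
  move=> W /small_expansion W_expands.
  apply: (mixture_expr_le d_gt0 y_ge1 b_gt0 b_le) W_expands.
  apply: leq_trans (edge_boundary_le_sum E W) _.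
  by rewrite (eq_bigr _ (fun v _ => rE v)) sum_nat_const.
have [_ trap_large _] := y_large.
exact: (small_trap_bound_le d_gt0 y_ge1 b_gt0 b_le d_large ny y_ge2 trap_large).
Qed.

Lemma bpr_adjacent_low_degrees_le :
  bpr E (base_miss d b y) (adjacent_low_degrees E k) <= expR (- (b / 4 * y)).
Proof.
apply: le_trans (bpr_adjacent_low_degrees k sE rE (unit_prob base_unit) x_unit) _.
have [_ _ low_large] := y_large.
exact: (low_degrees_bound_le d_gt0 y_ge1 b_gt0 b_le d_large ny
  (card_edges_le sE rE) d_le low_large).
Qed.

Lemma bpr_some_bad_cut_le (H : {set {set T}}) :
  H \subset E -> ~~ adjacent_low_degrees E k H ->
  bexp E (major_miss R d) (fun H1 =>
    bpr E (minor_miss R d) (some_bad_cut E k component_size H H1))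
  <= 2 * expR 1 * expR (- (1 / 2 * y)).
Proof.
move=> HE no_low_pair; apply: le_trans (bad_cut_bound_le k y_ge1 ny).
have kd : (2 * k <= d)%N.
  rewrite -(ler_nat R) natrM; have : b * d%:R <= 1 / 2 * d%:R by rewrite ler_wpM2r.
  by move: d_large kR_ge0; lra.
have minor_le : minor_miss R d <= link_decay R d.
  by rewrite ler_expR lerN2 ler_piMr ?invr_ge0 //; lra.
by apply: (bpr_some_bad_cut sE rE kd (unit_prob major_unit) (unit_prob minor_unit)
  minor_le (expR_ge0 _) (ltW c_gt0) (vertex_unlinked_le R d_gt0)
  (fun t r => links_decay_le d_gt0 y_ge1 c_gt0) expansion).
Qed.

Lemma process_prob_same_hitting_time_ge :
  1 - process_prob R (same_hitting_time (E := E) k)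
  <= (2 * expR 5 + 3 + 2 * expR 1) * expR (- (b / 4 * y)).
Proof.
have kT : (k < #|T|)%N.
  rewrite -(ltr_nat R) ny; apply: lt_le_trans (expR_ge1Dx y).
  by case: y_large => y_ge _ _; lra.
apply: le_trans (process_prob_same_hitting_time_union sE k_gt0 kT (unit_prob base_unit)
  (unit_prob major_unit) (unit_prob minor_unit) _ bpr_some_bad_cut_le) _.
  by rewrite !mulr_ge0 ?expR_ge0.
apply: le_trans (lerD (lerD (lerD bpr_min_degree_gt0_le bpr_has_small_trap_le)
  bpr_adjacent_low_degrees_le) (lexx _)) _.
have half_le : expR (- (1 / 2 * y)) <= expR (- (b / 4 * y)).
  by rewrite ler_expR lerN2 ler_wpM2r //; move: y_ge1 b_le; lra.
have := ler_wpM2l (expR_ge0 1) half_le.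
by move: half_le; lra.
Qed.

End SameHittingTime.

Local Open Scope classical_set_scope.

Theorem theorem1p1 (R : realType) :
  exists eps0 : R, 0 < eps0 /\
  forall (k : nat) (c : R), 0 < c ->
  exists C : R, 0 < C /\
  forall (a eps : R), 0 < a -> 0 < eps -> eps <= eps0 ->
  forall (d n : nat -> nat) (V : nat -> finType)
         (E : forall i, {set {set V i}}),
    (forall i, (0 < d i)%N) ->
    (forall i, (0 < n i)%N) ->
    n @ \oo --> \oo ->
    d @ \oo --> \oo ->
    (forall i, (d i)%:R <= (n i)%:R `^ (1 - a) :> R) ->
    (forall i, #|V i| = n i) ->
    (forall i, simple_graph (E i)) ->
    (forall i, regular (d i) (E i)) ->
    (forall i (U : {set V i}), #|U|%:R <= (n i)%:R / 2 :> R ->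
       c * #|U|%:R <= (edge_boundary (E i) U)%:R) ->
    (forall i (U : {set V i}), #|U|%:R <= C * (d i)%:R * ln (n i)%:R ->
       (1 - eps) * (d i)%:R * #|U|%:R <= (edge_boundary (E i) U)%:R) ->
  process_prob R (fun s : #|E i|.-tuple {set V i} =>
    hitting_time (min_degree_ge k) s == hitting_time (k_connected k) s)
    @[i --> \oo] --> (1 : R).
Proof.
exists (1 / 20); split=> [|k c c_gt0]; first lra.
exists (8 * (k%:R + 2) / c); split; first by rewrite divr_gt0 // mulr_gt0 // ltr_wpDl.
move=> a eps a_gt0 _ eps_le d n V E _ n_gt0 noo doo d_le cardV sE rE expansion.
move=> small_expansion; have [->|k_gt0] := posnP k.
  rewrite (_ : (fun i => _) = fun=> 1 :> R); first exact: cvg_cst.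
  by apply/funext => i; apply: process_prob_same_hitting_time0; rewrite cardV.
pose b := Num.min a (1 / 2); have b_gt0 : 0 < b by rewrite lt_min a_gt0 /=; lra.
have [b_le_a b_le] : b <= a /\ b <= 1 / 2 by rewrite !ge_min !lexx orbT.
have lny := cvg_ln_natr (R := R) noo.
apply: (cvg1_expRN_le (divr_gt0 b_gt0 (ltr0n _ 4)) lny) => [i|].
  exact: process_prob_le1.
near=> i; rewrite -(cardV i).
apply: (process_prob_same_hitting_time_ge (sE i) (rE i) k_gt0 c_gt0 b_gt0 b_le).
- by rewrite cardV; near: i; apply: (lny _ (near_large_enough k b_gt0)).
- rewrite [leRHS]mulrC -ler_pdivrMr //; near: i.
  exact: (proj1 (cvgryPge _) (proj2 (cvgrnyP _) doo)).
- by rewrite cardV (le_trans (d_le i)) // powR_le_expR_ln // ler1n.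
- by rewrite cardV; apply: expansion.
- move=> U; rewrite /component_size cardV => /small_expansion; apply: le_trans.
  by rewrite !ler_wpM2r //; lra.
Unshelve. all: by end_near. Qed.
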